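(* A set $X\subset\mathbb{R}^d$ is complementary regular if and only if there exist a compact set $Y\subset\mathbb{R}^d$ and a real $\varepsilon>0$ which is a regular value of $d_Y$ such that $X=Y^{\varepsilon}=\{x: d_Y(x)\le\varepsilon\}$.
   Context: $d_A(x)=\inf_{a\in A}\|x-a\|$. For a locally Lipschitz $\phi$, the Clarke gradient $\partial\phi(x)$ is the convex hull of all limits $\lim_i\nabla\phi(x_i)$ with $x_i\to x$ and $\phi$ differentiable at $x_i$; $\varepsilon$ is a regular value of $\phi$ if $0\notin\partial\phi(x)$ for all $x\in\phi^{-1}(\varepsilon)$. $\Delta(B)=\inf_{b\in B}\|b\|$. Complement set $\mathcal{C}A:=\overline{\mathbb{R}^d\setminus A}$. Reach of closed $A$: supremum of $t\ge0$ such that every $x$ with $d_A(x)<t$ has a unique nearest point in $A$. For $\mu\in(0,1]$, $\operatorname{reach}_\mu(A)=\sup\{s:\Delta(\partial d_A(x))\ge\mu\text{ for all }x\text{ with }0<d_A(x)\le s\}$. A compact $X$ is complementary regular if (i) $\overline{\operatorname{int}X}=X$, (ii) $\operatorname{reach}_\mu(X)>0$ for some $\mu\in(0,1]$, (iii) $\operatorname{reach}(\mathcal{C}X)>0$. *)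

(* Defs.v *)
(* MathComp + MathComp-Analysis, over an abstract R : realType.
   Points of R^d are row vectors 'rV[R]_d.  The library norm on 'rV is the
   max-norm, so the Euclidean norm, distance function etc. are defined here
   explicitly.  Topological notions (compact, closure, interior, convergence)
   are taken from the library: the product topology on 'rV[R]_d coincides with
   the Euclidean topology. *)
From HB Require Import structures.
From mathcomp Require Import all_boot all_order all_algebra.
From mathcomp Require Import all_classical all_reals all_analysis.
Set Implicit Arguments. Unset Strict Implicit. Unset Printing Implicit Defensive.
Import Order.TTheory GRing.Theory Num.Theory.
Import numFieldNormedType.Exports.
Local Open Scope classical_set_scope.
Local Open Scope ring_scope.

Section Defs.
Variables (R : realType) (d : nat).
Local Notation V := 'rV[R]_d.

Definition edot (x y : V) : R := \sum_(i < d) x 0 i * y 0 i.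
Definition enorm (x : V) : R := Num.sqrt (edot x x).

(* d_A(x) = inf_{a in A} ||x - a||, valued in extended reals (+oo if A empty) *)
Definition edistf (A : set V) (x : V) : \bar R :=
  ereal_inf [set (enorm (x - a))%:E | a in A].

(* real-valued version d_A (for nonempty A it is exactly d_A) *)
Definition distf (A : set V) (x : V) : R := fine (edistf A x).

Definition has_grad (f : V -> R) (x g : V) : Prop :=
  forall e : R, 0 < e -> exists2 del : R, 0 < del &
    forall h : V, enorm h < del ->
      `| f (x + h) - f x - edot g h | <= e * enorm h.

Definition limit_grad (f : V -> R) (x g : V) : Prop :=
  exists (xs gs : nat -> V),
    (forall n, has_grad f (xs n) (gs n)) /\
    (xs @ \oo --> x) /\ (gs @ \oo --> g).

Definition clarke_grad (f : V -> R) (x : V) : set V :=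
  [set v | exists (n : nat) (w : 'I_n -> R) (g : 'I_n -> V),
     [/\ forall i, 0 <= w i, \sum_(i < n) w i = 1,
         forall i, limit_grad f x (g i) &
         v = \sum_(i < n) w i *: g i]].

Definition regular_value (phi : V -> R) (eps : R) : Prop :=
  forall x, phi x = eps -> ~ clarke_grad phi x 0.

Definition Delta (B : set V) : \bar R := ereal_inf [set (enorm b)%:E | b in B].

Definition compl_set (A : set V) : set V := closure (~` A).

Definition reach (A : set V) : \bar R :=
  ereal_sup [set t%:E | t in [set t : R | 0 <= t /\
     forall x, (edistf A x < t%:E)%E ->
       exists! a, A a /\ (enorm (x - a))%:E = edistf A x]].

Definition reach_mu (mu : R) (A : set V) : \bar R :=
  ereal_sup [set s%:E | s in [set s : R |
     forall x, 0 < distf A x <= s -> (mu%:E <= Delta (clarke_grad (distf A) x))%E]].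

Definition comp_regular (X : set V) : Prop :=
  [/\ compact X,
      closure (interior X) = X,
      (exists2 mu : R, 0 < mu <= 1 & (0 < reach_mu mu X)%E) &
      (0 < reach (compl_set X))%E].

End Defs.

(* Main.v *)
Require Import Defs.
From HB Require Import structures.
From mathcomp Require Import all_boot all_order all_algebra.
From mathcomp Require Import all_classical all_reals all_analysis.
From mathcomp Require Import ring lra.
Import Order.TTheory GRing.Theory Num.Theory.
Import numFieldNormedType.Exports.
Local Open Scope classical_set_scope.
Local Open Scope ring_scope.

(** Off A, the Clarke gradient of d_A at x is the convex hull of the unit
    vectors (x - a) / d_A(x), with a ranging over the nearest points of x: d_A is
    differentiable inside each segment [x, a], and a gradient of d_A can only be
    such a unit vector.  Hence 0 lies outside the Clarke gradient if and only if
    d_A grows linearly in some direction.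

    If eps is a regular value of d_Y, upper semicontinuity of nearest points
    bounds the gradients away from 0 near the level eps, and d_X = d_Y - eps
    outside X = Y^eps, so reach_mu X > 0.  The complement set is C = {d_Y >= eps};
    an outer normal x - p of C at p is a nonnegative combination of the vectors
    a - p with a nearest to p in Y, since otherwise one could move from p inside C
    towards x.  As C avoids the open balls B(a, eps), this gives a uniform
    exterior ball condition, that is, a positive reach.

    Conversely let C be the complement set of X and Y = {d_C >= eps} with eps
    below the reach of C.  Unique nearest points make d_C grow at rate 1, so from
    x in the interior of X one climbs to Y within distance eps - d_C(x), and
    X = Y^eps.  If 0 were in the Clarke gradient of d_Y at x with d_Y(x) = eps, then
    d_Y(z)^2 <= eps^2 + |z - x|^2; but reach_mu X > 0 lets d_Y climb linearly
    starting outside X arbitrarily close to x. *)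

Set Implicit Arguments.
Unset Strict Implicit.
Unset Printing Implicit Defensive.

(** * Euclidean structure of row vectors *)

Section Euclid.
Context {R : realType} {d : nat}.
Local Notation V := 'rV[R]_d.
Implicit Types (x y z : V) (A : set V).

Lemma edotC x y : edot x y = edot y x.
Proof. by apply: eq_bigr => i _; rewrite mulrC. Qed.

Lemma edotDl x y z : edot (x + y) z = edot x z + edot y z.
Proof. by rewrite -big_split; apply: eq_bigr => i _; rewrite mxE mulrDl. Qed.

Lemma edotZl (k : R) x y : edot (k *: x) y = k * edot x y.
Proof. by rewrite mulr_sumr; apply: eq_bigr => i _; rewrite mxE mulrA. Qed.

Lemma edotNl x y : edot (- x) y = - edot x y.
Proof. by rewrite -scaleN1r edotZl mulN1r. Qed.

Lemma edotDr x y z : edot x (y + z) = edot x y + edot x z.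
Proof. by rewrite edotC edotDl !(edotC x). Qed.

Lemma edotZr (k : R) x y : edot x (k *: y) = k * edot x y.
Proof. by rewrite edotC edotZl edotC. Qed.

Lemma edotNr x y : edot x (- y) = - edot x y.
Proof. by rewrite edotC edotNl edotC. Qed.

Definition edotE := (edotDl, edotDr, edotNl, edotNr, edotZl, edotZr).

Lemma edot0l x : edot 0 x = 0.
Proof. by rewrite -(scale0r x) edotZl mul0r. Qed.

Lemma edot_sumr n (f : 'I_n -> V) x :
  edot x (\sum_(i < n) f i) = \sum_(i < n) edot x (f i).
Proof.
elim/big_rec2: _ => [|i y1 y2 _ <-]; first by rewrite edotC edot0l.
by rewrite edotDr.
Qed.

Lemma edot_ge0 x : 0 <= edot x x.
Proof. by apply: sumr_ge0 => i _; rewrite -expr2 sqr_ge0. Qed.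

Lemma edot_eq0 x : edot x x = 0 -> x = 0.
Proof.
move=> /eqP; rewrite psumr_eq0 => [/allP h|i _]; last by rewrite -expr2 sqr_ge0.
apply/rowP => i; rewrite mxE; have := h i; rewrite mem_index_enum => /(_ isT).
by rewrite -expr2 sqrf_eq0 => /eqP.
Qed.

Lemma enorm_ge0 x : 0 <= enorm x. Proof. exact: sqrtr_ge0. Qed.

Lemma sqr_enorm x : enorm x ^+ 2 = edot x x.
Proof. by rewrite sqr_sqrtr ?edot_ge0. Qed.

Lemma enorm0 : enorm (0 : V) = 0.
Proof. by rewrite /enorm edot0l sqrtr0. Qed.

Lemma enorm_eq0 x : enorm x = 0 -> x = 0.
Proof. by move=> h; apply: edot_eq0; rewrite -sqr_enorm h expr0n. Qed.

Lemma enormN x : enorm (- x) = enorm x.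
Proof. by rewrite /enorm !edotE opprK. Qed.

Lemma enormB x y : enorm (x - y) = enorm (y - x).
Proof. by rewrite -enormN opprB. Qed.

Lemma enormZ (k : R) x : enorm (k *: x) = `|k| * enorm x.
Proof. by rewrite /enorm !edotE mulrA -expr2 sqrtrM ?sqr_ge0// sqrtr_sqr. Qed.

Lemma enormZ_ge0 (k : R) x : 0 <= k -> enorm (k *: x) = k * enorm x.
Proof. by move=> k0; rewrite enormZ ger0_norm. Qed.

Lemma enorm_le (r : R) x : 0 <= r -> edot x x <= r ^+ 2 -> enorm x <= r.
Proof. by move=> r0; rewrite -sqr_enorm ler_sqr ?nnegrE// enorm_ge0. Qed.

(** Cauchy-Schwarz: expand the square of [enorm y *: x - enorm x *: y] and divide by the product of
    the norms; the case of a zero product is separate. *)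
Lemma edot_le_enorm x y : edot x y <= enorm x * enorm y.
Proof.
have x0 := enorm_ge0 x; have y0 := enorm_ge0 y.
have := edot_ge0 (enorm y *: x - enorm x *: y).
rewrite !edotE (edotC y x) -!sqr_enorm => h.
have [xy0|xy0] := eqVneq (enorm x * enorm y) 0; last by nra.
move: xy0 => /eqP; rewrite mulf_eq0 => /orP[]/eqP/enorm_eq0 ->.
  by rewrite enorm0 mul0r edot0l.
by rewrite enorm0 mulr0 edotC edot0l.
Qed.

Lemma ler_enormD x y : enorm (x + y) <= enorm x + enorm y.
Proof.
apply: enorm_le; first by rewrite addr_ge0 ?enorm_ge0.
rewrite !edotE (edotC y x) -!sqr_enorm; have := edot_le_enorm x y.
by nra.
Qed.

Lemma enorm_triangle y x z : enorm (x - z) <= enorm (x - y) + enorm (y - z).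
Proof. by rewrite (_ : x - z = (x - y) + (y - z)) ?ler_enormD// addrA subrK. Qed.

Lemma norm_le_enorm x : `|x| <= enorm x.
Proof.
rewrite [`|x|]mx_normrE; apply: bigmax_le => [|[i j] _] /=; first exact: enorm_ge0.
rewrite ord1 -sqrtr_sqr ler_wsqrtr// /edot (bigD1 j)//= -expr2 lerDl.
by apply: sumr_ge0 => k _; rewrite -expr2 sqr_ge0.
Qed.

Lemma enorm_le_norm x : enorm x <= d%:R * `|x|.
Proof.
have h i : `|x 0 i| <= `|x|.
  rewrite [leRHS]mx_normrE; exact: (le_bigmax _ (fun ij : 'I_1 * 'I_d => `|x ij.1 ij.2|) (0, i)).
apply: enorm_le; first by rewrite mulr_ge0.
have : edot x x <= d%:R * `|x| ^+ 2.
  rewrite (_ : d%:R * _ = \sum_(i < d) `|x| ^+ 2); last first.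
    by rewrite sumr_const card_ord mulr_natl.
  apply: ler_sum => i _; rewrite -expr2 -real_normK ?num_real//.
  by rewrite ler_sqr ?nnegrE.
move=> /le_trans -> //; rewrite exprMn ler_wpM2r ?sqr_ge0//.
by rewrite -natrX ler_nat; case: (d) => // n; rewrite leq_pmulr.
Qed.

(** Bridge between the max-norm topology of the library and Euclidean balls: each norm bounds the
    other up to the factor [d]. *)
Lemma nbhs_enormP x (U : set V) :
  nbhs x U <-> exists2 e : R, 0 < e & forall y, enorm (y - x) < e -> U y.
Proof.
split=> [/nbhs_ballP[e /= e0 h]|[e e0 h]].
  exists e => // y hy; apply: h; rewrite -ball_normE /= -normrN opprB.
  exact: le_lt_trans (norm_le_enorm _) hy.
(* Dividing by [d.+1] rather than [d] also covers dimension 0. *)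
apply/nbhs_ballP; exists (e / d.+1%:R) => /=; first by rewrite divr_gt0.
move=> y; rewrite -ball_normE /= -normrN opprB ltr_pdivlMr// => hy; apply: h.
apply: le_lt_trans (enorm_le_norm _) (le_lt_trans _ hy).
by rewrite mulrC ler_wpM2l// ler_nat.
Qed.

Lemma enorm_cvg0 (u : nat -> V) x : u @ \oo --> x ->
  forall e : R, 0 < e -> \forall n \near \oo, enorm (u n - x) < e.
Proof.
move=> ux e e0; apply: (ux [set y | enorm (y - x) < e]).
by apply/nbhs_enormP; exists e.
Qed.

Lemma lipschitz_continuous (f : V -> R) (k : R) :
  (forall x y, f x - f y <= k * enorm (x - y)) -> continuous f.
Proof.
move=> h x; apply/(@cvgrPdist_lt _ _ _ (nbhs x) (nbhs_filter x)) => e e0.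
have c0 : 0 < e / (`|k| + 1) by rewrite divr_gt0// ltr_wpDl.
have : nbhs x [set y | enorm (y - x) < e / (`|k| + 1)].
  by apply/nbhs_enormP; exists (e / (`|k| + 1)).
apply: filterS => y /=; rewrite ltr_pdivlMr ?ltr_wpDl// => hy.
apply: le_lt_trans hy; have := h x y; have := h y x; rewrite (enormB x y).
have : k * enorm (y - x) <= enorm (y - x) * (`|k| + 1).
  by rewrite mulrC ler_wpM2l ?enorm_ge0// ler_wpDr// ler_norm.
by move=> a b c; rewrite ler_norml; lra.
Qed.

Lemma edot_continuous x : continuous (edot x).
Proof.
apply: (@lipschitz_continuous _ (enorm x)) => y z.
by rewrite -edotNr -edotDr edot_le_enorm.
Qed.

Lemma enorm_continuous a : continuous (fun x => enorm (x - a)).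
Proof.
apply: (@lipschitz_continuous _ 1) => y z; rewrite mul1r.
by have := enorm_triangle z y a; lra.
Qed.

Lemma enorm_bounded_compact A a (r : R) : closed A ->
  (forall x, A x -> enorm (x - a) <= r) -> compact A.
Proof.
move=> cA bA; apply: bounded_closed_compact => //.
exists (`|a| + r); split; first exact: num_real.
move=> M hM x /bA h; apply: le_trans (ltW hM).
rewrite -[x](subrK a) addrC; apply: le_trans (ler_normD _ _) _.
by rewrite lerD2l; apply: le_trans h; exact: norm_le_enorm.
Qed.

Lemma compact_enorm_bounded A : compact A ->
  exists2 r : R, 0 < r & forall x, A x -> enorm x <= r.
Proof.
move=> cA; have [->|/set0P A0] := eqVneq A set0; first by exists 1.
have [c _ hc] := compact_EVT_max A0 cA (continuous_subspaceT (@enorm_continuous 0)).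
exists (enorm c + 1) => [|x Ax]; first by rewrite ltr_wpDl ?enorm_ge0.
by have := hc x; rewrite inE !subr0 => /(_ Ax); lra.
Qed.

End Euclid.

(** * Convex hulls *)

Section Hull.
Context {R : realType} {d : nat}.
Local Notation V := 'rV[R]_d.
Implicit Types (v x y : V) (K : set V).

Definition nhull n K : set V :=
  [set v | exists (w : 'I_n -> R) (g : 'I_n -> V),
     [/\ forall i, 0 <= w i, \sum_(i < n) w i = 1,
         forall i, K (g i) & v = \sum_(i < n) w i *: g i]].

(* clarke_grad f x is convertible to hull (limit_grad f x). *)
Definition hull K : set V := [set v | exists n, nhull n K v].

Lemma nhull_pad n K : nhull n.+1 K `<=` nhull n.+2 K.
Proof.
move=> v [w [g [w0 w1 gK ->]]].
(* The extra point gets weight 0 and repeats an existing one, which is why at least one point is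
   required. *)
exists (fun i => if unlift ord0 i is Some j then w j else 0).
exists (fun i => if unlift ord0 i is Some j then g j else g ord0).
split=> [i|||].
- by case: unliftP.
- rewrite big_ord_recl unlift_none add0r -w1.
  by apply: eq_bigr => i _; rewrite liftK.
- by move=> i; case: unliftP.
- rewrite [RHS]big_ord_recl unlift_none scale0r add0r.
  by apply: eq_bigr => i _; rewrite liftK.
Qed.

(** The matrix with rows [(1, g i)] has more rows than columns, so its left kernel is nonzero. The
    column of ones makes the coefficients sum to 0, hence one of them is positive. *)
Lemma affine_dependence n (g : 'I_n.+1 -> V) : (d < n)%N ->
  exists c : 'I_n.+1 -> R, [/\ exists i, 0 < c i, \sum_i c i = 0 &
    \sum_i c i *: g i = 0].
Proof.
move=> dn; pose M := row_mx (const_mx 1 : 'cV[R]_n.+1) (\matrix_i g i).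
have kM : kermx M != 0.
  rewrite -mxrank_eq0 mxrank_ker -lt0n subn_gt0 (leq_ltn_trans (rank_leq_col _))//.
pose c := nz_row (kermx M).
have c0 : c != 0 by rewrite nz_row_eq0.
have cM : c *m M = 0 by apply/sub_kermxP; exact: nz_row_sub.
have [c1 cg] : c *m (const_mx 1 : 'cV[R]_n.+1) = 0 /\ c *m \matrix_i g i = 0.
  by move: cM; rewrite mul_mx_row -[RHS]row_mx0 => /eq_row_mx.
have sc : \sum_i c 0 i = 0.
  by move/matrixP: c1 => /(_ 0 0); rewrite !mxE; under eq_bigr do rewrite mxE mulr1.
exists (fun i => c 0 i); split => //.
- apply: contrapT => /forallNP h; move/eqP: c0; apply.
  have h0 i : 0 <= - c 0 i by rewrite oppr_ge0 leNgt; apply/negP; exact: h.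
  have : \sum_i - c 0 i == 0 by rewrite sumrN sc oppr0.
  rewrite psumr_eq0// => /allP hc; apply/rowP => i; rewrite mxE.
  by have := hc i; rewrite mem_index_enum oppr_eq0 => /(_ isT)/eqP.
- by rewrite -[RHS]cg mulmx_sum_row; apply: eq_bigr => i _; rewrite rowK.
Qed.

(* Along an affine dependence c the point v is unchanged, and the largest step
   keeping the weights nonnegative kills one of them. *)
Lemma nhull_drop n K : (d < n)%N -> nhull n.+1 K `<=` nhull n K.
Proof.
move=> dn v [w [g [w0 w1 gK ->]]].
have [c [[i1 ci1] c0 cg]] := affine_dependence g dn.
have [i0 ci0 hi0] := @arg_minP _ _ _ i1 (fun i => 0 < c i) (fun i => w i / c i) ci1.
pose t := w i0 / c i0; pose w' i := w i - t * c i.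
have t0 : 0 <= t by rewrite divr_ge0// ltW.
have w'i0 : w' i0 = 0 by rewrite /w' /t divfK ?subrr// gt_eqF.
exists (w' \o lift i0), (g \o lift i0); split=> [i|||] //=.
- rewrite /w' subr_ge0; move: (lift i0 i) => j.
  have [cj|cj] := ltP 0 (c j); first by rewrite -ler_pdivlMr// hi0.
  by apply: le_trans (w0 j); rewrite mulr_ge0_le0.
- have <- : \sum_i w' i = 1 by rewrite sumrB -mulr_sumr c0 mulr0 subr0.
  by rewrite [RHS](bigD1_ord i0)//= w'i0 add0r.
- have -> : \sum_i w i *: g i = \sum_i w' i *: g i.
    under [RHS]eq_bigr do rewrite scalerBl -scalerA.
    by rewrite sumrB -scaler_sumr cg scaler0 subr0.
  by rewrite [LHS](bigD1_ord i0)//= w'i0 scale0r add0r.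
Qed.

(** Shorter combinations are padded and longer ones lose a point at a time. A fixed number of points
    is what compactness of the hull needs. *)
Lemma caratheodory K : hull K = nhull d.+1 K.
Proof.
apply/seteqP; split=> v; last by exists d.+1.
move=> [[|n] vn]; first by case: vn => w [g [_]]; rewrite big_ord0 => /esym/eqP; rewrite oner_eq0.
have [nd|dn] := leqP n d.
  rewrite -(subnK nd) -addnS; elim: (d - n)%N => // k ih.
  by rewrite addSn addnS; apply: nhull_pad; rewrite -addnS.
move: vn; rewrite -(subnK dn); elim: (n - d.+1)%N => [|k ih].
  by rewrite add0n => /nhull_drop; apply.
by rewrite addSn => vn; apply: ih; apply: nhull_drop vn; exact/leqW/leq_addl.
Qed.

Lemma coord_continuousV n (i : 'I_n) :
  continuous (fun G : 'rV['rV[R]_d]_n => G 0 i).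
Proof.
move=> /= M s /=; rewrite nbhs_simpl /= => sM.
exists (fun (i' : 'I_1) (j' : 'I_n) => [set x | j' = i -> s x]) => [i' j'|my /= h].
  rewrite ord1; have [->|ji] := eqVneq j' i; first by apply: filterS sM => x sx.
  by apply: (@filterE _ _ (nbhs_filter (M 0 j'))) => x jE; rewrite jE eqxx in ji.
exact: (h 0 i).
Qed.

(** By Caratheodory the hull is the continuous image of the standard simplex times a power of
    [K]. *)
Lemma hull_compact K : compact K -> compact (hull K).
Proof.
move=> cK; rewrite caratheodory.
pose n := d.+1.
pose S := [set w : 'rV[R]_n | forall i, `[0, 1]%classic (w 0 i)] `&`
  [set w | \sum_(i < n) w 0 i = 1].
pose T := [set G : 'rV['rV[R]_d]_n | forall i, K (G 0 i)].
pose f (p : 'rV[R]_n * 'rV['rV[R]_d]_n) : V := \sum_i p.1 0 i *: p.2 0 i.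
have cS : compact S.
  apply: compact_closedI; first by apply: (@rV_compact R n (fun=> `[0, 1]%classic)) => i; exact: segment_compact.
  have cs : continuous (fun w : 'rV[R]_n => \sum_(i < n) w 0 i).
    by apply: (continuous_big (@add_continuous R)) => i _; exact: coord_continuous.
  by apply: (preimage_closed _ (@closed_eq R 1)) => w _; exact: cs.
have cT : compact T by apply: (@rV_compact V n (fun=> K)).
have cf : continuous f.
  apply: (continuous_big (@add_continuous V)) => i _ p; apply: cvgZ.
    by apply: (@continuous_comp _ _ _ fst (fun w : 'rV[R]_n => w 0 i));
      [exact: cvg_fst|exact: coord_continuous].
  by apply: (@continuous_comp _ _ _ snd (fun w : 'rV['rV[R]_d]_n => w 0 i));
      [exact: cvg_snd|exact: coord_continuousV].
have := continuous_compact (continuous_subspaceT cf) (compact_setX cS cT).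
congr (compact _); apply/seteqP; split=> v.
  move=> [[w G] /= [[w01 w1] GK] <-]; exists (fun i => w 0 i), (fun i => G 0 i).
  by split=> // i; have := w01 i; rewrite /= in_itv /= => /andP[].
move=> [w [g [w0 w1 gK ->]]]; exists (\row_i w i, \row_i g i) => /=.
  split; last by move=> i; rewrite mxE.
  split=> /= [i|]; last by under eq_bigr do rewrite mxE.
  rewrite mxE in_itv /= w0 /= -w1 (bigD1 i)//= lerDl.
  by apply: sumr_ge0.
by apply: eq_bigr => i _; rewrite !mxE.
Qed.

Lemma sub_hull K : K `<=` hull K.
Proof.
move=> k Kk; exists 1%N, (fun=> 1), (fun=> k); split => //; rewrite big_ord1 //.
by rewrite scale1r.
Qed.

Lemma hullS K K' : K `<=` K' -> hull K `<=` hull K'.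
Proof.
move=> KK' v [n [w [g [w0 w1 gK ->]]]]; exists n, w, g; split=> // i.
exact/KK'/gK.
Qed.

Lemma hull_segment K (t : R) v k : 0 <= t <= 1 -> hull K v -> K k ->
  hull K ((1 - t) *: v + t *: k).
Proof.
move=> /andP[t0 t1] [n [w [g [w0 w1 gK ->]]]] Kk; exists n.+1.
exists (fun i => if unlift ord0 i is Some j then (1 - t) * w j else t).
exists (fun i => if unlift ord0 i is Some j then g j else k).
split=> [i|||].
- by case: unliftP => // j _; rewrite mulr_ge0// subr_ge0.
- rewrite big_ord_recl unlift_none; under eq_bigr do rewrite liftK.
  by rewrite -mulr_sumr w1 mulr1 addrC subrK.
- by move=> i; case: unliftP.
- rewrite [RHS]big_ord_recl unlift_none addrC; congr (_ + _).
  by rewrite scaler_sumr; apply: eq_bigr => i _; rewrite liftK scalerA.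
Qed.

Lemma hull_edot_ge K v u (m : R) : hull K v -> (forall k, K k -> m <= edot u k) ->
  m <= edot u v.
Proof.
move=> [n [w [g [w0 w1 gK ->]]]] h; rewrite edot_sumr.
rewrite -[m]mul1r -w1 mulr_suml; apply: ler_sum => i _.
by rewrite edotZr ler_wpM2l// h.
Qed.

(** [v] is the point of least norm in the hull; the inequality is its first-order optimality on the
    segment towards [k]. *)
Lemma hull_min K : compact K -> K !=set0 ->
  exists2 v, hull K v & forall k, K k -> edot v v <= edot v k.
Proof.
move=> cK [k0 Kk0].
have [|v] := compact_EVT_min _ (hull_compact cK) (continuous_subspaceT (@enorm_continuous _ _ 0)).
  by exists k0; exact: sub_hull.
rewrite inE => hv vmin; exists v => // k Kk.
have key t : 0 <= t <= 1 -> 0 <= 2 * t * (edot v k - edot v v) + t ^+ 2 * edot (k - v) (k - v).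
  move=> t01; have := vmin _ (mem_set (hull_segment t01 hv Kk)).
  rewrite !subr0 -ler_sqr ?nnegrE ?enorm_ge0// !sqr_enorm.
  by rewrite !edotE (edotC k v); lra.
rewrite leNgt; apply/negP => lt_vk.
set a := edot v v - edot v k; set b := edot (k - v) (k - v).
have a0 : 0 < a by rewrite subr_gt0.
have b0 : 0 <= b by exact: edot_ge0.
(* This step lies in [0, 1] and makes the quadratic [- 2 * t * a + t ^+ 2 * b] negative, against
   minimality. *)
have := key (a / (a + b)).
have ab : 0 < a + b by rewrite ltr_wpDr.
rewrite divr_ge0 ?(ltW ab) ?(ltW a0)// ler_pdivrMr// mul1r lerDl b0 => /(_ isT).
rewrite (_ : edot v k - edot v v = - a); last by rewrite /a; ring.
rewrite -/b (_ : _ + _ = - (a / (a + b)) * (a * (2 - b / (a + b)))); last by ring.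
rewrite leNgt => /negP; apply; rewrite nmulr_rlt0 ?oppr_lt0 ?divr_gt0//.
rewrite mulr_gt0// subr_gt0 ltr_pdivrMr//; nra.
Qed.

(** Strict separation from the origin by the normalized point of least norm in the hull. *)
Lemma hull0P K : compact K -> ~ hull K 0 ->
  exists w (c : R), [/\ 0 < c, enorm w <= 1 & forall k, K k -> c <= edot w k].
Proof.
move=> cK nK; have [->|/set0P K0] := eqVneq K set0.
  by exists 0, 1; rewrite enorm0; split.
have [v hv vmin] := hull_min cK K0.
have v0 : 0 < enorm v.
  rewrite lt_neqAle enorm_ge0 andbT; apply/eqP => /esym/enorm_eq0 v0.
  by apply: nK; rewrite -v0.
exists ((enorm v)^-1 *: v), (enorm v); split=> // [|k /vmin].
  by rewrite enormZ_ge0 ?mulVf ?invr_ge0 ?gt_eqF// ltW.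
by rewrite -sqr_enorm expr2 edotZl ler_pdivlMl.
Qed.

End Hull.

(** * Distance functions *)

Section Distance.
Context {R : realType} {d : nat}.
Local Notation V := 'rV[R]_d.
Implicit Types (x y z a : V) (A : set V).

Definition nearest A x : set V := [set a | A a /\ enorm (x - a) = distf A x].

Lemma edistf_ge0 A x : (0 <= edistf A x)%E.
Proof. by apply: le_ereal_inf_tmp => _ [a _ <-]; rewrite lee_fin enorm_ge0. Qed.

Lemma distf_ge0 A x : 0 <= distf A x.
Proof. by rewrite fine_ge0// edistf_ge0. Qed.

Lemma edistf_le A x a : A a -> (edistf A x <= (enorm (x - a))%:E)%E.
Proof. by move=> Aa; apply: ereal_inf_lbound; exists a. Qed.

Lemma edistfE A x : A !=set0 -> edistf A x = (distf A x)%:E.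
Proof.
move=> [a Aa]; rewrite fineK// ge0_fin_numE ?edistf_ge0//.
exact: le_lt_trans (edistf_le x Aa) (ltry _).
Qed.

Lemma edistf_set0 x : edistf set0 x = +oo%E.
Proof. by rewrite /edistf image_set0 ereal_inf0. Qed.

Lemma distf_le A x a : A a -> distf A x <= enorm (x - a).
Proof. by move=> Aa; rewrite -lee_fin -edistfE ?edistf_le//; exists a. Qed.

Lemma le_distf A x (r : R) : A !=set0 -> (forall a, A a -> r <= enorm (x - a)) ->
  r <= distf A x.
Proof.
move=> A0 h; rewrite -lee_fin -edistfE//; apply: le_ereal_inf_tmp => _ [a Aa <-].
by rewrite lee_fin h.
Qed.

Lemma distf_lipschitz A x y : distf A x - distf A y <= enorm (x - y).
Proof.
(* On the empty set [edistf] is infinite and [distf] takes the default value 0. *)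
have [->|/set0P A0] := eqVneq A set0.
  by rewrite /distf !edistf_set0 subrr enorm_ge0.
rewrite lerBlDr addrC -lerBlDr; apply: le_distf => // a Aa.
by have := enorm_triangle y x a; have := distf_le x Aa; lra.
Qed.

Lemma distf_continuous A : continuous (distf A).
Proof.
by apply: (@lipschitz_continuous _ _ _ 1) => x y; rewrite mul1r distf_lipschitz.
Qed.

Lemma distf_id A x : A x -> distf A x = 0.
Proof.
move=> Ax; apply/eqP; rewrite eq_le distf_ge0 andbT.
by have := distf_le x Ax; rewrite subrr enorm0.
Qed.

Lemma closed_enorm_le x (r : R) : closed [set a : V | enorm (a - x) <= r].
Proof. by apply: (preimage_closed _ (@closed_le R r)) => w _; exact: enorm_continuous. Qed.

Lemma closed_min_enorm A x : closed A -> A !=set0 ->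
  exists2 a, A a & forall b, A b -> enorm (x - a) <= enorm (x - b).
Proof.
move=> cA [a0 Aa0]; pose B := A `&` [set a | enorm (a - x) <= enorm (a0 - x)].
have cB : compact B.
  apply: (@enorm_bounded_compact _ _ _ x (enorm (a0 - x))) => [|a []//].
  by apply: closedI => //; exact: closed_enorm_le.
have [|a] := compact_EVT_min _ cB (continuous_subspaceT (@enorm_continuous _ _ x)).
  by exists a0; split => /=.
rewrite inE => -[Aa ax] amin; exists a => // b Ab; rewrite !(enormB x).
have [bB|/ltW bB] := leP (enorm (b - x)) (enorm (a0 - x)).
  by apply: amin; rewrite inE.
exact: le_trans ax bB.
Qed.

Lemma nearest_nonempty A x : closed A -> A !=set0 -> nearest A x !=set0.
Proof.
move=> cA A0; have [a Aa amin] := closed_min_enorm x cA A0.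
by exists a; split => //; apply/eqP; rewrite eq_le distf_le// le_distf.
Qed.

Lemma distf_eq0 A x : closed A -> A !=set0 -> distf A x = 0 -> A x.
Proof.
move=> cA A0; have [a [Aa <-]] := nearest_nonempty x cA A0.
by move=> /enorm_eq0/eqP; rewrite subr_eq0 => /eqP ->.
Qed.

(** Upper semicontinuity of the nearest-point map: points of [A] outside [U] are farther from [x]
    than [distf A x] by a definite gap, and moving [x] by less than half of it keeps them from being
    nearest. *)
Lemma nearest_usc A x (U : set V) : closed A -> A !=set0 -> open U ->
  nearest A x `<=` U ->
  exists2 e : R, 0 < e & forall y, enorm (y - x) < e -> nearest A y `<=` U.
Proof.
move=> cA A0 oU xU; have [AU|/set0P AU] := eqVneq (A `\` U) set0.
  by exists 1 => // y _ a [Aa _]; apply: contrapT => Ua; have : (A `\` U) a by []; rewrite AU.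
have cAU : closed (A `\` U) by rewrite setDE; apply: closedI => //; exact: open_closedC.
have [b [Ab nUb] bmin] := closed_min_enorm x cAU AU.
have xb : distf A x < enorm (x - b).
  rewrite lt_neqAle distf_le// andbT; apply/eqP => /esym xb.
  by apply: nUb; apply: xU.
exists ((enorm (x - b) - distf A x) / 2); first by rewrite divr_gt0// subr_gt0.
move=> y yx a [Aa ya]; apply: contrapT => Ua.
have := bmin a (conj Aa Ua); have := enorm_triangle y x a.
by have := distf_lipschitz A y x; rewrite ya (enormB x y); lra.
Qed.

Lemma nearest_compact A x : closed A -> compact (nearest A x).
Proof.
move=> cA; apply: (@enorm_bounded_compact _ _ _ x (distf A x)); last first.
  by move=> a [_ <-]; rewrite enormB.
have -> : nearest A x = A `&` [set a | enorm (a - x) = distf A x].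
  by apply/seteqP; split=> a /= [? ?]; split=> //=; rewrite enormB.
apply: closedI => //; apply: (preimage_closed _ (@closed_eq R _)) => w _.
exact: enorm_continuous.
Qed.

(* Danskin: the one-sided derivative of the distance in the direction w is the
   minimum of <w, (z - a) / |z - a|> over the nearest points a. *)
Lemma distf_ascent A z w (s : R) : closed A -> A !=set0 -> 0 <= s -> 0 < distf A z ->
  (forall a, nearest A z a -> s * distf A z < edot w (z - a)) ->
  exists2 e : R, 0 < e & forall t, 0 < t < e ->
    distf A z + s * t < distf A (z + t *: w).
Proof.
move=> cA A0 s0 Dz h.
have cn := @nearest_compact A z cA.
(* Compactness of the set of nearest points turns the strict inequality into a uniform margin
   [c]. *)
have [c [c0 hc]] : exists c, 0 < c /\ forall a, nearest A z a -> s * distf A z + c < edot w (z - a).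
  have [a0 na0 amin] : exists2 a, nearest A z a & forall b, nearest A z b -> edot w (z - a) <= edot w (z - b).
    have [a] := compact_EVT_max (nearest_nonempty z cA A0) cn (continuous_subspaceT (@edot_continuous _ _ w)).
    rewrite inE => na amax; exists a => // b nb; rewrite !edotE.
    by rewrite lerD2l lerN2 amax// inE.
  exists ((edot w (z - a0) - s * distf A z) / 2); split.
    by rewrite divr_gt0// subr_gt0 h.
  by move=> a /amin; have := h _ na0; lra.
pose U := [set a | s * distf A z + c < edot w z - edot w a].
have oU : open U.
  have -> : U = edot w @^-1` [set r | r < edot w z - (s * distf A z + c)].
    by apply/seteqP; split => a; rewrite /U /=; lra.
  apply: open_comp; last exact: open_lt.
  by move=> a _; exact: edot_continuous.
have [|e e0 he] := @nearest_usc A z U cA A0 oU.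
  by move=> a /hc; rewrite /U /= !edotE.
pose k := enorm w + s ^+ 2 + 1.
have k0 : 0 < k by rewrite ltr_wpDl// addr_ge0 ?sqr_ge0 ?enorm_ge0.
(* The first bound keeps the nearest points of [z + t *: w] in [U]; the second lets the margin [c]
   absorb [t * s ^+ 2]. *)
exists (Num.min (e / k) (c / k)); first by rewrite lt_min !divr_gt0.
move=> t /andP[t0]; rewrite lt_min !ltr_pdivlMr// => /andP[tek tck].
have [a na] := nearest_nonempty (z + t *: w) cA A0.
have Ua : U a.
  apply: he na; rewrite addrC addKr enormZ_ge0 ?(ltW t0)//.
  apply: le_lt_trans tek; rewrite ler_wpM2l ?(ltW t0)// /k.
  by have := sqr_ge0 s; lra.
case: na => Aa <-; rewrite -ltr_sqr ?nnegrE ?enorm_ge0 ?addr_ge0 ?mulr_ge0 ?(ltW t0) ?distf_ge0//.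
have za : distf A z ^+ 2 <= edot (z - a) (z - a).
  by rewrite -sqr_enorm ler_sqr ?nnegrE ?enorm_ge0 ?distf_ge0// distf_le.
rewrite sqr_enorm (addrAC z) [ltRHS]edotDr !(edotDl (z - a)) !edotZl !edotZr.
rewrite (edotC (z - a) w); move: Ua; rewrite /U /= => Ua.
have ww : 0 <= edot w w := edot_ge0 w.
have tts : t * (t * s ^+ 2) < t * c.
  rewrite ltr_pM2l//; apply: le_lt_trans tck; rewrite ler_pM2l// /k.
  by have := enorm_ge0 w; lra.
have tU : t * (s * distf A z + c) < t * (edot w (z - a)).
  by rewrite ltr_pM2l// !edotE.
have tww : 0 <= t * (t * edot w w) by rewrite !mulr_ge0// ltW.
nra.
Qed.

(* An Ekeland-type argument: maximize D - s |. - x0| over the ball; the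
   maximizer cannot be interior. *)
Lemma distf_climb A x0 (r s : R) : 0 < r -> 0 <= s ->
  (forall z, enorm (z - x0) < r -> distf A x0 + s * enorm (z - x0) <= distf A z ->
     forall e : R, 0 < e -> exists y, enorm (y - z) < e /\
        distf A z + s * enorm (y - z) < distf A y) ->
  exists z, enorm (z - x0) <= r /\ distf A x0 + s * r <= distf A z.
Proof.
move=> r0 s0 h; pose B := [set z : V | enorm (z - x0) <= r].
have cB : compact B by apply: (@enorm_bounded_compact _ _ _ x0 r) => //; exact: closed_enorm_le.
pose f z := distf A z - s * enorm (z - x0).
have cf : continuous f.
  apply: (@lipschitz_continuous _ _ _ (1 + s)) => x y; rewrite /f.
  have := distf_lipschitz A x y; have := enorm_triangle x y x0.
  by rewrite (enormB y x) => h1 h2; nra.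
have B0 : B !=set0 by exists x0; rewrite /B /= subrr enorm0 ltW.
have [z] := compact_EVT_max B0 cB (continuous_subspaceT cf).
rewrite inE => Bz zmax; exists z; split => //.
have fz : distf A x0 + s * enorm (z - x0) <= distf A z.
  have := zmax x0; rewrite inE /B /= subrr enorm0 => /(_ (ltW r0)).
  by rewrite /f subrr enorm0; lra.
suff -> : r = enorm (z - x0) by [].
apply/eqP; rewrite eq_le [X in _ && X]Bz andbT leNgt; apply/negP => zr.
have [|y [yz hy]] := h z zr fz (r - enorm (z - x0)); first by rewrite subr_gt0.
have yB : enorm (y - x0) <= r by have := enorm_triangle z y x0; lra.
have := zmax y; rewrite inE => /(_ yB); rewrite /f.
by have := enorm_triangle z y x0; nra.
Qed.

End Distance.

(** * Clarke gradients of distance functions *)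

Section ClarkeDistance.
Context {R : realType} {d : nat}.
Local Notation V := 'rV[R]_d.
Implicit Types (x y z a g : V) (A : set V) (f : V -> R).

Definition normals A x : set V :=
  (fun a => (distf A x)^-1 *: (x - a)) @` nearest A x.

Lemma normals_compact A x : closed A -> compact (normals A x).
Proof.
move=> cA; suff cf : continuous (fun a => (distf A x)^-1 *: (x - a)).
  exact: continuous_compact (continuous_subspaceT cf) (@nearest_compact _ _ A x cA).
move=> a U /nbhs_enormP[e e0 he]; apply/nbhs_enormP.
set k := (distf A x)^-1 in he *.
have k0 : 0 <= k by rewrite invr_ge0 distf_ge0.
exists (e / (k + 1)) => [|b]; first by rewrite divr_gt0// ltr_wpDl.
rewrite ltr_pdivlMr ?ltr_wpDl// => ba; apply: he.
rewrite -scalerBr enormZ_ge0// (_ : x - b - (x - a) = a - b); last by apply/rowP => i; rewrite !mxE; ring.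
rewrite enormB.
by have := enorm_ge0 (b - a); nra.
Qed.

(** The upper bound is the distance to [a] itself, the lower one the 1-Lipschitz property. *)
Lemma distf_segment A x a (t : R) : nearest A x a -> 0 <= t <= 1 ->
  distf A (x + t *: (a - x)) = (1 - t) * distf A x.
Proof.
move=> [Aa xa] /andP[t0 t1].
have e1 : enorm (x + t *: (a - x) - a) = (1 - t) * distf A x.
  rewrite (_ : _ - a = (1 - t) *: (x - a)) ?enormZ_ge0 ?subr_ge0 ?xa//.
  by apply/rowP => i; rewrite !mxE; ring.
have := distf_le (x + t *: (a - x)) Aa; rewrite e1 => h1.
have := distf_lipschitz A x (x + t *: (a - x)).
rewrite opprD addNKr enormN enormZ_ge0// enormB xa => h2.
by apply/eqP; rewrite eq_le h1 /=; lra.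
Qed.

(** The Lipschitz bound gives [enorm g <= 1], and slope -1 towards [a] forces equality in
    Cauchy-Schwarz. The local constant [c] allows [f] to be the distance to an offset of [A]. *)
Lemma has_grad_nearest A f x g a (c del : R) : 0 < del ->
  (forall y, enorm (y - x) < del -> f y = distf A y + c) ->
  0 < distf A x -> nearest A x a -> has_grad f x g -> x - a = distf A x *: g.
Proof.
move=> del0 fE.
move=> Dx na hg; have [Aa xa] := na; set D := distf A x in Dx xa *.
have fx : f x = D + c by rewrite fE// subrr enorm0.
(* Otherwise a short step along [g] raises the distance by more than the length of the step. *)
have g1 : enorm g <= 1.
  rewrite leNgt; apply/negP => g1; have g0 : 0 < enorm g by lra.
  have [|e e0 he] := hg ((enorm g - 1) / 2); first by lra.
  pose t := Num.min e del / (2 * enorm g).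
  have m0 : 0 < Num.min e del by rewrite lt_min e0.
  have t0 : 0 < t by rewrite divr_gt0// mulr_gt0.
  have tg : t * enorm g = Num.min e del / 2.
    by rewrite /t; field; rewrite gt_eqF.
  have tgm : enorm (t *: g) < Num.min e del by rewrite enormZ_ge0 ?(ltW t0)// tg; lra.
  move: (tgm); rewrite lt_min => /andP[tge tgd].
  have fh : f (x + t *: g) = distf A (x + t *: g) + c by rewrite fE// addrC addKr.
  have := he _ tge; rewrite fh fx edotZr -sqr_enorm.
  have := distf_lipschitz A (x + t *: g) x; rewrite [x + _]addrC addrK -/D.
  rewrite enormZ_ge0 ?(ltW t0)// => h1; rewrite ler_norml => /andP[h2 _].
  have : t * enorm g * (enorm g - 1) <= t * enorm g * ((enorm g - 1) / 2) by nra.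
  by rewrite ler_pM2l ?(mulr_gt0 t0 g0)//; lra.
(* Test the gradient on a short step towards [a], where the distance is known exactly. *)
have gD : D <= edot g (x - a).
  rewrite leNgt; apply/negP => gD; set u := edot g (x - a) in gD.
  have [|e e0 he] := hg ((D - u) / (2 * D)).
    by rewrite divr_gt0 ?mulr_gt0// subr_gt0.
  pose m := Num.min e (Num.min del D).
  have m0 : 0 < m by rewrite !lt_min e0 del0 Dx.
  have mD : m <= D by rewrite !ge_min lexx !orbT.
  pose t := m / (2 * D).
  have t0 : 0 < t by rewrite divr_gt0// mulr_gt0.
  have tD : t * D = m / 2 by rewrite /t; field; rewrite gt_eqF.
  have t1 : 0 <= t <= 1 by rewrite (ltW t0) /t ler_pdivrMr ?mulr_gt0//; lra.
  have en : enorm (t *: (a - x)) = t * D by rewrite enormZ_ge0 ?(ltW t0)// enormB xa.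
  have tm : enorm (t *: (a - x)) < m by rewrite en tD; lra.
  move: (tm); rewrite !lt_min => /and3P[te td _].
  have fh : f (x + t *: (a - x)) = distf A (x + t *: (a - x)) + c.
    by rewrite fE// addrC addKr.
  have := he _ te; rewrite fh fx (distf_segment na t1) -/D en.
  rewrite edotZr -(opprB x a) edotNr -/u ler_norml => /andP[h _].
  have e2 : (D - u) / (2 * D) * (t * D) = t * (D - u) / 2 by field; rewrite gt_eqF.
  have tDu : 0 < t * (D - u) by apply: mulr_gt0; rewrite ?subr_gt0.
  by move: h; rewrite e2; lra.
(* The square of [x - a - D *: g] is at most [D ^+ 2 - 2 * D ^+ 2 + D ^+ 2], which is 0. *)
apply/eqP; rewrite -subr_eq0; apply/eqP/edot_eq0/eqP.
rewrite eq_le edot_ge0 andbT !edotE.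
have : edot g g <= 1 by rewrite -sqr_enorm expr_le1 ?enorm_ge0.
have : edot (x - a) (x - a) = D ^+ 2 by rewrite -sqr_enorm xa.
move: gD; rewrite !edotE (edotC a x) (edotC x g) (edotC a g) => h1 h2 h3.
have : D * D <= D * (edot g x - edot g a) by rewrite ler_pM2l.
have : D * D * edot g g <= D * D by rewrite ler_piMr// mulr_ge0 ?ltW.
by nra.
Qed.

(** At each [xs n] the point [xs n - distf A (xs n) *: gs n] is nearest in [A]. The limit
    [x - D *: g] stays in the closed set [A], and [enorm g <= 1] makes it nearest to [x]. *)
Lemma limit_grad_sub A f x (c del : R) : closed A -> A !=set0 -> 0 < del ->
  (forall y, enorm (y - x) < del -> f y = distf A y + c) ->
  0 < distf A x -> limit_grad f x `<=` normals A x.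
Proof.
move=> cA A0 del0 fE Dx g [xs [gs [hgr [xsx gsg]]]]; set D := distf A x in Dx *.
have key (e : R) : 0 < e -> exists b g', [/\ A b, enorm (b - (x - D *: g)) < e,
    enorm g' = 1 & enorm (g' - g) < e].
  (* [del / 2] preserves the formula for [f] around [xs n], [D / 2] keeps the distance positive, and
     the other bounds make three error terms less than [e / 4] each. *)
  move=> e0; pose e1 := Num.min (e / 4) (Num.min (del / 2) (D / 2)).
  pose e2 := Num.min e (e / (4 * D)).
  have e10 : 0 < e1 by rewrite !lt_min !divr_gt0.
  have e20 : 0 < e2 by rewrite !lt_min e0 !divr_gt0// mulr_gt0.
  have [N1 _ hN1] := enorm_cvg0 xsx e10; have [N2 _ hN2] := enorm_cvg0 gsg e20.
  pose n := maxn N1 N2.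
  have xn : enorm (xs n - x) < e1 by apply: hN1; exact: leq_maxl.
  have gn : enorm (gs n - g) < e2 by apply: hN2; exact: leq_maxr.
  move: xn gn; rewrite /e1 /e2 !lt_min => /and3P[xn1 xn2 xn3] /andP[gn1 gn2].
  have [b nb] := nearest_nonempty (xs n) cA A0.
  have Dn : 0 < distf A (xs n).
    by have := distf_lipschitz A x (xs n); rewrite enormB -/D; lra.
  have fEn y : enorm (y - xs n) < del / 2 -> f y = distf A y + c.
    by move=> yn; apply: fE; have := enorm_triangle (xs n) y x; lra.
  have bE := has_grad_nearest (divr_gt0 del0 (ltr0n _ 2)) fEn Dn nb (hgr n).
  have gn_eq1 : enorm (gs n) = 1.
    have [_] := nb; rewrite bE enormZ_ge0 ?(ltW Dn)// => /eqP.
    by rewrite -[X in _ == X]mulr1 => /eqP/mulfI; apply; rewrite gt_eqF.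
  exists b, (gs n); split => //; first by case: nb.
  have -> : b - (x - D *: g) = (xs n - x) + ((D - distf A (xs n)) *: gs n + D *: (g - gs n)).
    rewrite scalerBl scalerBr -bE; apply/rowP => i; rewrite !mxE; ring.
  apply: le_lt_trans (ler_enormD _ _) _.
  have := ler_enormD ((D - distf A (xs n)) *: gs n) (D *: (g - gs n)).
  rewrite !enormZ gn_eq1 mulr1 (gtr0_norm Dx) (enormB g).
  have : `|D - distf A (xs n)| <= enorm (xs n - x).
    rewrite ler_norml; have := distf_lipschitz A x (xs n).
    by have := distf_lipschitz A (xs n) x; rewrite (enormB x) -/D; lra.
  have : D * enorm (gs n - g) < e / 4.
    by move: gn2; rewrite !ltr_pdivlMr ?mulr_gt0//; lra.
  by lra.
have Aa : A (x - D *: g).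
  apply: contrapT => nA; have : nbhs (x - D *: g) (~` A).
    by apply: open_nbhs_nbhs; split => //; exact: closed_openC.
  move=> /nbhs_enormP[e e0 he]; have [b [g' [Ab bh _ _]]] := key e e0.
  exact: (he b).
have g1 : enorm g <= 1.
  rewrite leNgt; apply/negP => g1.
  have [|_ [g' [_ _ g'1 gg']]] := key (enorm g - 1); first by rewrite subr_gt0.
  by have := enorm_triangle g' g 0; rewrite !subr0 g'1 enormB; lra.
have DgE : x - (x - D *: g) = D *: g by rewrite opprB addrC subrK.
exists (x - D *: g); last by rewrite DgE scalerA mulVf ?scale1r// gt_eqF.
split=> //; apply/eqP; rewrite eq_le distf_le// andbT DgE enormZ_ge0 ?(ltW Dx)//.
by rewrite ler_piMr// ltW.
Qed.

(* sqrt (r^2 + q) <= r + q / (2 r) *)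
Lemma enorm_upper (r : R) x h : 0 < r -> enorm x = 1 ->
  enorm (r *: x + h) <= r + edot x h + edot h h / (2 * r).
Proof.
move=> r0 x1; set L := enorm _.
have L0 : 0 <= L := enorm_ge0 _.
have LE : L ^+ 2 = r ^+ 2 + 2 * r * edot x h + edot h h.
  rewrite /L sqr_enorm !edotE (edotC h x) -sqr_enorm x1; ring.
have -> : r + edot x h + edot h h / (2 * r) = (r ^+ 2 + L ^+ 2) / (2 * r).
  by rewrite LE; field; rewrite gt_eqF.
by rewrite ler_pdivlMr ?mulr_gt0//; have := sqr_ge0 (L - r); nra.
Qed.

(* In the interior of the segment from x to a nearest point a, the distance
   function is squeezed between two smooth functions that touch there. *)
Lemma has_grad_segment A x a (t : R) : 0 < distf A x -> nearest A x a -> 0 < t < 1 ->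
  has_grad (distf A) (x + t *: (a - x)) ((distf A x)^-1 *: (x - a)).
Proof.
move=> Dx na /andP[t0 t1]; have [Aa xa] := na; set D := distf A x in Dx xa *.
set u := D^-1 *: (x - a).
have u1 : enorm u = 1 by rewrite enormZ_ge0 ?invr_ge0 ?(ltW Dx)// xa mulVf// gt_eqF.
have uE : x - a = D *: u by rewrite scalerA divff ?scale1r// gt_eqF.
have aE : a - x = - (D *: u) by rewrite -uE opprB.
move=> e e0; pose m := Num.min t (1 - t).
have m0 : 0 < m by rewrite lt_min t0 subr_gt0.
(* [D * m] is at most the distance of the base point from both [x] and [a], so both quadratic
   remainders are at most [e * enorm h]. *)
exists (2 * (D * m) * e); first by rewrite !mulr_gt0.
move=> h hh; have hh0 := enorm_ge0 h.
have small (r : R) : D * m <= r -> edot h h / (2 * r) <= e * enorm h.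
  move=> Dr; have r0 : 0 < r by apply: lt_le_trans Dr; rewrite mulr_gt0.
  rewrite ler_pdivrMr ?mulr_gt0// -sqr_enorm expr2 mulrAC ler_wpM2r//.
  apply: le_trans (ltW hh) _.
  have : D * m * e <= r * e by apply: ler_wpM2r => //; exact: ltW.
  by lra.
rewrite (distf_segment na) ?(ltW t0) ?(ltW t1)// -/D.
have up : distf A (x + t *: (a - x) + h) <= (1 - t) * D + edot u h + e * enorm h.
  apply: le_trans (distf_le _ Aa) _.
  have -> : x + t *: (a - x) + h - a = ((1 - t) * D) *: u + h.
    by rewrite -scalerA -uE; apply/rowP => i; rewrite !mxE; ring.
  apply: le_trans (enorm_upper _ _ u1) _; first by rewrite mulr_gt0// subr_gt0.
  rewrite lerD2l small// mulrC ler_wpM2r ?(ltW Dx)//.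
  by rewrite ge_min lexx orbT.
have lo : (1 - t) * D + edot u h - e * enorm h <= distf A (x + t *: (a - x) + h).
  have := distf_lipschitz A x (x + t *: (a - x) + h).
  have -> : x - (x + t *: (a - x) + h) = (t * D) *: u + - h.
    by rewrite -scalerA -uE; apply/rowP => i; rewrite !mxE; ring.
  have tD : 0 < t * D by rewrite mulr_gt0.
  have := enorm_upper (- h) tD u1; rewrite !edotE opprK -/D.
  have : edot h h / (2 * (t * D)) <= e * enorm h.
    by rewrite small// mulrC ler_wpM2r ?(ltW Dx)// ge_min lexx.
  by lra.
by rewrite ler_norml; lra.
Qed.

Lemma normals_sub A x : 0 < distf A x -> normals A x `<=` limit_grad (distf A) x.
Proof.
move=> Dx _ [a na <-].
(* The shift [n.+2] keeps the parameter strictly between 0 and 1; along the segment the gradient is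
   constant. *)
exists (fun n => x + n.+2%:R^-1 *: (a - x)), (fun=> (distf A x)^-1 *: (x - a)).
split; first by move=> n; apply: has_grad_segment; rewrite // invr_gt0 ltr0n invf_lt1 ?ltr1n ?ltr0n.
split; last exact: cvg_cst.
move=> U /nbhs_enormP[e e0 he]; have [N _ hN] := near_infty_natSinv_lt (PosNum (divr_gt0 e0 Dx)).
exists N => // n Nn; apply: he; rewrite [x + _]addrC addrK.
rewrite enormZ_ge0 ?invr_ge0// enormB; case: na => _ ->.
rewrite -ltr_pdivlMr//; apply: lt_trans (hN n Nn).
by rewrite ltf_pV2 ?posrE// ltr_nat.
Qed.

Lemma clarke_distf_sub A f x (c del : R) : closed A -> A !=set0 -> 0 < del ->
  (forall y, enorm (y - x) < del -> f y = distf A y + c) ->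
  0 < distf A x -> clarke_grad f x `<=` hull (normals A x).
Proof.
move=> cA A0 del0 fE Dx v [n [w [g [w0 w1 gn ->]]]]; exists n, w, g; split=> // i.
exact: (limit_grad_sub cA A0 del0 fE Dx (gn i)).
Qed.

Lemma sub_clarke_distf A x : 0 < distf A x ->
  hull (normals A x) `<=` clarke_grad (distf A) x.
Proof. by move=> Dx; apply: hullS => v; exact: normals_sub. Qed.

Lemma hull_normals_edot A x w v (m : R) : 0 < distf A x ->
  (forall a, nearest A x a -> m * distf A x <= edot w (x - a)) ->
  hull (normals A x) v -> m <= edot w v.
Proof.
move=> Dx h hv; apply: hull_edot_ge hv _ => _ [a /h na <-].
by rewrite edotZr mulrC ler_pdivlMr.
Qed.

End ClarkeDistance.

(** * Sublevel sets at regular values *)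

Section OffsetRegular.
Context {R : realType} {d : nat}.
Local Notation V := 'rV[R]_d.
Implicit Types (x y z a p q v : V) (A Y : set V).

Lemma distf_offset Y x (eps : R) : closed Y -> Y !=set0 -> 0 <= eps -> eps < distf Y x ->
  distf [set y | distf Y y <= eps] x = distf Y x - eps.
Proof.
move=> cY Y0 e0 ex; set X := [set y | _].
have [a na] := nearest_nonempty x cY Y0; have [Ya xa] := na.
have X0 : X !=set0 by exists a; rewrite /X /= distf_id.
apply/eqP; rewrite eq_le; apply/andP; split.
  have Dx : 0 < distf Y x by apply: le_lt_trans ex.
  (* This is the point of the segment from [x] to [a] at distance exactly [eps] from [Y]. *)
  pose t := 1 - eps / distf Y x.
  have t01 : 0 <= t <= 1.
    by rewrite /t subr_ge0 ler_pdivrMr// mul1r (ltW ex) gerBl divr_ge0// ltW.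
  have Xt : X (x + t *: (a - x)).
    rewrite /X /= (distf_segment na t01) /t opprB addrC subrK divfK// gt_eqF//.
  apply: le_trans (distf_le x Xt) _.
  have /andP[t0 _] := t01.
  rewrite opprD addNKr enormN enormZ_ge0// enormB xa.
  by rewrite /t mulrBl mul1r divfK// gt_eqF.
apply: le_distf => // y; rewrite /X /= => yX.
by have := distf_lipschitz Y x y; lra.
Qed.

(** A compactness argument over [K]: off the level [eps] the claim is locally vacuous for small [s],
    and on it a separating vector for the normals at [x] still separates at nearby points. *)
Lemma normals_uniform Y (eps : R) : compact Y -> Y !=set0 -> 0 < eps ->
  regular_value (distf Y) eps ->
  exists2 s : R, 0 < s & forall x v, eps <= distf Y x <= eps + s ->
    hull (normals Y x) v -> s <= enorm v.
Proof.
move=> kY Y0 e0 reg; have cY := compact_closed (@norm_hausdorff _ _) kY.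
pose K := [set x | distf Y x <= eps + 1].
have cK : compact K.
  have [r r0 hr] := compact_enorm_bounded kY.
  apply: (@enorm_bounded_compact _ _ _ 0 (eps + 1 + r)).
    apply: (preimage_closed _ (@closed_le R (eps + 1))) => w _.
    exact: distf_continuous.
  move=> x; rewrite /K /= subr0 => xK.
  have [a [Ya xa]] := nearest_nonempty x cY Y0.
  by have := enorm_triangle a x 0; rewrite !subr0 xa; have := hr a Ya; lra.
pose P (s : R) x := eps <= distf Y x <= eps + s ->
  forall v, hull (normals Y x) v -> s <= enorm v.
have : \forall s \near 0^'+, K `<=` P s.
  apply: ((compact_near_coveringP K).1 cK) => x Kx.
  have [ltx|] := ltP (distf Y x) eps.
    exists ([set y | enorm (y - x) < eps - distf Y x], setT).
      split; last exact: filterT.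
      by apply/nbhs_enormP; exists (eps - distf Y x); rewrite ?subr_gt0.
    move=> [y s] /= [yx _] /andP[ey _]; have := distf_lipschitz Y y x; lra.
  rewrite le_eqVlt => /orP[/eqP ex|gtx]; last first.
    pose m := (distf Y x - eps) / 2; have m0 : 0 < m by rewrite divr_gt0// subr_gt0.
    exists ([set y | enorm (y - x) < m], [set s | s < m]).
      by split; [apply/nbhs_enormP; exists m|exact: nbhs_right_lt].
    move=> [y s] /= [yx sm] /andP[_ ey]; have := distf_lipschitz Y x y.
    by rewrite enormB /m in yx sm *; lra.
  have Dx : 0 < distf Y x by rewrite -ex.
  have nh : ~ hull (normals Y x) 0.
    by move=> /(sub_clarke_distf Dx); exact: reg.
  have [w [c [c0 w1 hw]]] := hull0P (@normals_compact _ _ Y x cY) nh.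
  have hw' a : nearest Y x a -> c * eps <= edot w x - edot w a.
    move=> na; have /hw : normals Y x ((distf Y x)^-1 *: (x - a)) by exists a.
    by rewrite edotZr mulrC ler_pdivlMr// -ex !edotE.
  have ce : 0 < c * eps by rewrite mulr_gt0.
  pose U := [set a | c * eps / 2 < edot w x - edot w a].
  have oU : open U.
    have -> : U = edot w @^-1` [set r | r < edot w x - c * eps / 2].
      by apply/seteqP; split => a; rewrite /U /=; lra.
    apply: open_comp; last exact: open_lt.
    by move=> a _; exact: edot_continuous.
  have [|e1 e10 he] := @nearest_usc _ _ Y x U cY Y0 oU.
    by move=> a /hw'; rewrite /U /=; lra.
  (* On [U] the product with [x - a] exceeds [c * eps / 2]; replacing [x] by [y] costs at most half
     of this, and [distf Y y] is below [eps + 1]. *)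
  pose m := Num.min e1 (c * eps / 4).
  pose b := Num.min 1 (c * eps / 4 / (eps + 1)).
  have b0 : 0 < b by rewrite lt_min ltr01 !divr_gt0// addr_gt0.
  exists ([set y | enorm (y - x) < m], [set s | s < b]).
    split; last exact: nbhs_right_lt.
    by apply/nbhs_enormP; exists m => //; rewrite lt_min e10 divr_gt0.
  move=> [y s] /= [yx sb] /andP[ey1 ey2] v hv; move: yx sb.
  rewrite /m /b !lt_min => /andP[yx1 yx2] /andP[s1 s2].
  have Dy : 0 < distf Y y by apply: lt_le_trans ey1.
  have : c * eps / 4 / (eps + 1) <= edot w v.
    apply: (hull_normals_edot Dy _ hv) => a /(he y yx1); rewrite /U /= => Ua.
    have h1 : c * eps / 4 <= edot w (y - a).
      have := edot_le_enorm w (x - y); rewrite enormB.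
      have : enorm w * enorm (y - x) <= enorm (y - x).
        by rewrite ler_piMl// enorm_ge0.
      by rewrite !edotE; lra.
    apply: le_trans h1; rewrite mulrAC ler_pdivrMr ?addr_gt0// ler_pM2l ?divr_gt0//.
    by lra.
  have := edot_le_enorm w v; have : enorm w * enorm v <= enorm v.
    by rewrite ler_piMl// enorm_ge0.
  by lra.
move=> hP; have /filter_ex[s [s0 hs]] : \forall s \near (0:R)^'+, 0 < s < 1 /\ K `<=` P s.
  near=> s; split; last by near: s; exact: hP.
  by apply/andP; split; near: s; [exact: nbhs_right_gt|exact: nbhs_right_lt].
case/andP: s0 => s0 s1; exists s => // x v xs hv; apply: (hs x) => //.
by rewrite /K /=; case/andP: xs => _; lra.
Unshelve. all: by end_near. Qed.

(** Collect the weight [S] carried by points of [K] and renormalize; if [S] is 0, any point of [K]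
    can serve as [u]. *)
Lemma hull_setU1 K b v : K !=set0 -> hull (K `|` [set b]) v ->
  exists t u, [/\ 0 <= t <= 1, hull K u & v = (1 - t) *: u + t *: b].
Proof.
move=> [k0 Kk0] [n [w [g [w0 w1 gK ->]]]].
pose P i := `[< K (g i) >].
pose S := \sum_(i | P i) w i.
have S0 : 0 <= S by apply: sumr_ge0.
have SE : 1 - S = \sum_(i | ~~ P i) w i.
  by rewrite -w1 (bigID P)/= addrAC subrr add0r.
have S1 : 0 <= 1 - S by rewrite SE sumr_ge0.
have gb i : ~~ P i -> g i = b by move=> /asboolPn; case: (gK i).
have vE : \sum_i w i *: g i = \sum_(i | P i) w i *: g i + (1 - S) *: b.
  rewrite (bigID P)/= SE scaler_suml; congr (_ + _).
  by apply: eq_bigr => i /gb ->.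
exists (1 - S); rewrite subKr.
have [S00|S00] := eqVneq S 0.
  exists k0; split; [lra|exact: sub_hull|].
  rewrite vE S00 scale0r; congr (_ + _); apply: big1 => i Pi.
  suff -> : w i = 0 by rewrite scale0r.
  by apply/eqP; move/eqP: S00; rewrite psumr_eq0// => /allP/(_ i); rewrite mem_index_enum Pi => /(_ isT).
exists (\sum_(i | P i) (w i / S) *: g i); split; first lra.
  exists n, (fun i => if P i then w i / S else 0), (fun i => if P i then g i else k0).
  split.
  - by move=> i; case: ifP => // _; rewrite divr_ge0.
  - by rewrite -big_mkcond -mulr_suml divff.
  - by move=> i; case: ifP => // /asboolP.
  - by rewrite big_mkcond; apply: eq_bigr => i _; case: ifP; rewrite ?scale0r.
rewrite vE; congr (_ + _); rewrite scaler_sumr; apply: eq_bigr => i _.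
by rewrite scalerA mulrCA divff ?mulr1.
Qed.

(* The normal cone of {D_Y >= eps} at p is spanned by the directions from p to
   its nearest points a in Y, and {D_Y >= eps} avoids the open balls B(a, eps). *)
Lemma superlevel_proximal Y (eps s : R) x p q : closed Y -> Y !=set0 -> 0 < eps ->
  0 < s -> (forall z v, distf Y z = eps -> hull (normals Y z) v -> s <= enorm v) ->
  nearest [set y | eps <= distf Y y] x p -> eps <= distf Y q ->
  2 * (eps * s) * edot (q - p) (x - p) <= enorm (x - p) * edot (q - p) (q - p).
Proof.
move=> cY Y0 e0 s0 hs [pC xp] qC; set C := [set y | _] in xp; rewrite /= in pC.
have [->|xnp] := eqVneq x p; first by rewrite subrr enorm0 (edotC _ 0) edot0l mulr0 mul0r.
have xp0 : 0 < enorm (x - p).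
  rewrite lt_neqAle enorm_ge0 andbT; apply/eqP => /esym/enorm_eq0/eqP.
  by rewrite subr_eq0 (negPf xnp).
(* A point closer to [x] than [p] cannot belong to [C]. *)
have closer w (t : R) : enorm (x - (p + t *: w)) < enorm (x - p) -> distf Y (p + t *: w) < eps.
  rewrite xp => h; rewrite ltNge; apply/negP => h'.
  by move: h; rewrite ltNge distf_le.
(* Otherwise [p] could move a little towards [x] without leaving [C]. *)
have pE : distf Y p = eps.
  apply/eqP; rewrite eq_le pC andbT leNgt; apply/negP => ep.
  pose t := Num.min (1 / 2) ((distf Y p - eps) / (2 * enorm (x - p))).
  have t0 : 0 < t by rewrite lt_min !divr_gt0 ?mulr_gt0// subr_gt0.
  have t12 : t <= 1 / 2 by rewrite ge_min lexx.
  have tp : t * enorm (x - p) <= (distf Y p - eps) / 2.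
    rewrite -ler_pdivlMr//; rewrite -mulrA -invfM; by rewrite ge_min lexx orbT.
  have : distf Y (p + t *: (x - p)) < eps.
    apply: closer; rewrite (_ : x - _ = (1 - t) *: (x - p)); last first.
      by apply/rowP => i; rewrite !mxE; ring.
    by rewrite enormZ_ge0; [rewrite gtr_pMl//; lra|lra].
  have := distf_lipschitz Y p (p + t *: (x - p)).
  rewrite opprD addNKr enormN enormZ_ge0 ?(ltW t0)//; lra.
have Dp : 0 < distf Y p by rewrite pE.
have N0 : normals Y p !=set0.
  by have [a na] := nearest_nonempty p cY Y0; exists ((distf Y p)^-1 *: (p - a)), a.
have cN : compact (normals Y p) by exact: normals_compact.
(* Otherwise a separating [w] is a direction that increases [distf Y] and approaches [x], against
   [closer]. *)
have h0 : hull (normals Y p `|` [set x - p]) 0.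
  apply: contrapT => nh; have c1 : compact [set x - p] by exact: compact_set1.
  have [w [c [c0 w1 hw]]] := hull0P (compactU cN c1) nh.
  have wx : c <= edot w (x - p) by apply: hw; right.
  have [a na|e1 e10 he] := @distf_ascent _ _ Y p w 0 cY Y0 (lexx 0) Dp.
    have := hw _ (or_introl (ex_intro2 _ _ a na erefl)).
    rewrite edotZr mul0r mulrC ler_pdivlMr// => h.
    by apply: lt_le_trans h; rewrite mulr_gt0.
  pose t := Num.min e1 c / 2.
  have m0 : 0 < Num.min e1 c by rewrite lt_min e10.
  have t0 : 0 < t by rewrite divr_gt0.
  have m1 : Num.min e1 c <= e1 by rewrite ge_min lexx.
  have m2 : Num.min e1 c <= c by rewrite ge_min lexx orbT.
  have te : t < e1 by rewrite /t; lra.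
  have tc : t < c by rewrite /t; lra.
  have := he t; rewrite t0 te mul0r addr0 => /(_ isT).
  suff : distf Y (p + t *: w) < eps by lra.
  apply: closer; rewrite -ltr_sqr ?nnegrE ?enorm_ge0// !sqr_enorm opprD addrA.
  rewrite [ltLHS]edotDl !(edotDr _ (x - p)) !edotNl !edotNr !edotZl !edotZr.
  rewrite (edotC (x - p) w).
  have : edot w w <= 1 by rewrite -sqr_enorm expr_le1 ?enorm_ge0.
  have : 0 <= edot w w by exact: edot_ge0.
  have : t * c <= t * edot w (x - p) by rewrite ler_pM2l.
  have : t * t < t * c by rewrite ltr_pM2l.
  by nra.
have [t [u [t01 hu]]] := hull_setU1 N0 h0.
have su := hs p u pE hu; move=> /esym/eqP; rewrite addr_eq0 => /eqP tE.
have Q0 : 0 <= edot (q - p) (q - p) by exact: edot_ge0.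
(* Expand [q - a] around [p]: its norm is at least [eps], which is the norm of [p - a]. *)
have qu : - (edot (q - p) (q - p) / (2 * eps)) <= edot (q - p) u.
  apply: (hull_normals_edot Dp _ hu) => a na; have [Ya pa] := na.
  have : eps ^+ 2 <= edot (q - a) (q - a).
    rewrite -sqr_enorm ler_sqr ?nnegrE ?enorm_ge0 ?(ltW e0)//.
    exact: le_trans qC (distf_le q Ya).
  have -> : q - a = (q - p) + (p - a) by rewrite addrA subrK.
  rewrite pE (edotDl (q - p)) !(edotDr _ (q - p)) -(sqr_enorm (p - a)) pa pE.
  rewrite (edotC (p - a)) => h.
  rewrite mulNr invfM mulrA divfK ?gt_eqF//.
  by lra.
case/andP: t01 => t0 t1.
(* If [t] were 0 then [u] would vanish, against the bound [s <= enorm u]. *)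
have tpos : 0 < t.
  rewrite lt_neqAle t0 andbT; apply/eqP => t00; move: tE.
  rewrite -t00 subr0 scale1r scale0r oppr0 => u0.
  by move: su; rewrite u0 enorm0; lra.
have e1 : t * edot (q - p) (x - p) = - ((1 - t) * edot (q - p) u).
  by rewrite -!edotZr tE edotNr opprK.
have e2 : t * enorm (x - p) = (1 - t) * enorm u.
  by rewrite -!enormZ_ge0 ?subr_ge0// tE enormN.
rewrite -(ler_pM2l tpos) mulrCA e1 [leRHS]mulrA e2.
have : (1 - t) * s <= (1 - t) * enorm u by rewrite ler_wpM2l// subr_ge0.
move: qu; rewrite -mulNr ler_pdivrMr ?mulr_gt0// => qu.
have : (1 - t) * - edot (q - p) (q - p) <= (1 - t) * (edot (q - p) u * (2 * eps)).
  by rewrite ler_wpM2l// subr_ge0.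
by nra.
Qed.

(** The reach is at least [eps * s]: for two nearest points [p], [q] of [x], [edot (q - p) (q - p)]
    is twice [edot (q - p) (x - p)], so the proximal inequality forces [p = q] once
    [enorm (x - p) < eps * s]. *)
Lemma superlevel_reach Y (eps s : R) : closed Y -> Y !=set0 -> 0 < eps -> 0 < s ->
  (forall x v, distf Y x = eps -> hull (normals Y x) v -> s <= enorm v) ->
  (0 < reach [set y | (eps <= distf Y y)%R])%E.
Proof.
move=> cY Y0 e0 s0 hs; set C := [set y | _].
have cC : closed C.
  by apply: (preimage_closed _ (@closed_ge R eps)) => w _; exact: distf_continuous.
apply: (@lt_le_trans _ _ (eps * s)%:E); first by rewrite lte_fin mulr_gt0.
apply: ereal_sup_ubound; exists (eps * s) => //; split; first by rewrite mulr_ge0 ?ltW.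
move=> x xt; have C0 : C !=set0.
  by apply/set0P/eqP => C0; move: xt; rewrite C0 edistf_set0.
rewrite edistfE// lte_fin in xt *; have [p np] := nearest_nonempty x cC C0.
have [Cp xp] := np; exists p; split=> [|q [Cq [xq]]]; first by rewrite xp.
have key := superlevel_proximal cY Y0 e0 s0 hs np Cq.
have xqp : edot (x - q) (x - q) = edot (x - p) (x - p).
  by rewrite -!sqr_enorm xp xq.
have qpE : edot (q - p) (q - p) = 2 * edot (q - p) (x - p).
  move: xqp; have -> : x - q = (x - p) - (q - p).
    by apply/rowP => i; rewrite !mxE; ring.
  rewrite (edotDl (x - p)) !(edotDr _ (x - p)) !edotNl !edotNr (edotC (x - p) (q - p)).
  by lra.
have Q0 : 0 <= edot (q - p) (q - p) := edot_ge0 _.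
suff /edot_eq0/eqP : edot (q - p) (q - p) = 0 by rewrite subr_eq0 => /eqP.
apply/eqP; rewrite eq_le Q0 andbT leNgt; apply/negP => Qpos.
have : enorm (x - p) * edot (q - p) (q - p) < eps * s * edot (q - p) (q - p).
  by rewrite ltr_pM2r// xp.
by rewrite {2}qpE; lra.
Qed.

(** The extended distance gives an empty offset for empty [Y]; for nonempty [Y] the real one can
    replace it. *)
Lemma edistf_sublevelE Y (eps : R) : Y !=set0 ->
  [set x | (edistf Y x <= eps%:E)%E] = [set x | distf Y x <= eps].
Proof. by move=> Y0; apply/seteqP; split=> x /=; rewrite edistfE// lee_fin. Qed.

(** At level [eps] regularity provides a direction of ascent, hence points outside the offset
    arbitrarily close by. *)
Lemma regular_sublevel_compl Y (eps : R) : closed Y -> Y !=set0 -> 0 < eps ->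
  regular_value (distf Y) eps ->
  compl_set [set x | distf Y x <= eps] = [set x | eps <= distf Y x].
Proof.
move=> cY Y0 e0 reg; apply/seteqP; split.
  rewrite /compl_set; have cC : closed [set x | eps <= distf Y x].
    by apply: (preimage_closed _ (@closed_ge R eps)) => w _; exact: distf_continuous.
  rewrite [X in _ `<=` X]((closure_id _).1 cC)//; apply: closureS => x /= /negP.
  by rewrite -ltNge => /ltW.
move=> x /=; rewrite le_eqVlt => /orP[/eqP ex|ex]; last first.
  by apply: subset_closure => /=; apply/negP; rewrite -ltNge.
have Dx : 0 < distf Y x by rewrite -ex.
have nh : ~ hull (normals Y x) 0.
  by move=> /(sub_clarke_distf Dx); exact: reg.
have [w [c [c0 w1 hw]]] := hull0P (@normals_compact _ _ Y x cY) nh.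
have [a na|e1 e10 he] := @distf_ascent _ _ Y x w 0 cY Y0 (lexx 0) Dx.
  have /hw : normals Y x ((distf Y x)^-1 *: (x - a)) by exists a.
  rewrite edotZr mul0r mulrC ler_pdivlMr//; apply: lt_le_trans.
  by rewrite mulr_gt0.
move=> U /nbhs_enormP[e e'0 he']; pose m := Num.min e1 e.
have m0 : 0 < m by rewrite lt_min e10.
have m1 : m <= e1 by rewrite ge_min lexx.
have m2 : m <= e by rewrite ge_min lexx orbT.
exists (x + (m / 2) *: w); split.
  apply/negP; rewrite -ltNge ex.
  by have := he (m / 2); rewrite mul0r addr0; apply; apply/andP; split; lra.
apply: he'; rewrite addrC addKr enormZ_ge0; last lra.
by have := enorm_ge0 w; nra.
Qed.

Lemma regular_sublevel_comp_regular Y (eps : R) : compact Y -> 0 < eps ->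
  regular_value (distf Y) eps -> comp_regular [set x | (edistf Y x <= eps%:E)%E].
Proof.
move=> kY e0 reg; have [->|/set0P Y0] := eqVneq Y set0.
  have -> : [set x : V | (edistf set0 x <= eps%:E)%E] = set0.
    by apply/seteqP; split=> x //=; rewrite edistf_set0.
  split; [exact: compact0|by rewrite interior0 closure0| |].
    exists 1; first by rewrite ltr01 lexx.
    apply: (@lt_le_trans _ _ 1%:E); first by rewrite lte_fin.
    apply: ereal_sup_ubound; exists 1 => // x.
    by rewrite /distf edistf_set0 ltxx.
  apply: (@lt_le_trans _ _ 1%:E); first by rewrite lte_fin.
  apply: ereal_sup_ubound; exists 1 => //; split => // x _.
  have C x' : compl_set (set0 : set V) x' by rewrite /compl_set setC0; exact: subset_closure.
  exists x; split; first by split=> //; rewrite edistfE ?distf_id ?subrr ?enorm0//; exists x.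
  move=> a [_]; rewrite edistfE; last by exists x.
  by rewrite (distf_id (C x)) => -[] /enorm_eq0/eqP; rewrite subr_eq0 => /eqP.
have cY := compact_closed (@norm_hausdorff _ _) kY.
rewrite edistf_sublevelE//; set X := [set x | _].
have cX : closed X.
  by apply: (preimage_closed _ (@closed_le R eps)) => w _; exact: distf_continuous.
have [s s0 hs] := normals_uniform kY Y0 e0 reg.
split.
- have [r r0 hr] := compact_enorm_bounded kY.
  apply: (@enorm_bounded_compact _ _ _ 0 (eps + r)) => // x Xx.
  have [a [Ya xa]] := nearest_nonempty x cY Y0; rewrite /X /= in Xx.
  by have := enorm_triangle a x 0; rewrite !subr0 xa; have := hr a Ya; lra.
- apply/seteqP; split.
    rewrite [X in _ `<=` X]((closure_id _).1 cX)//; apply: closureS.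
    exact: interior_subset.
  have int x : distf Y x < eps -> interior X x.
    move=> xe; apply/nbhs_enormP; exists (eps - distf Y x); first by rewrite subr_gt0.
    by move=> y yx; rewrite /X /=; have := distf_lipschitz Y y x; lra.
  (* A point at level [eps] enters the open sublevel set after a short step towards a nearest point
     of [Y]. *)
  move=> x Xx; have [xe|ex] := ltP (distf Y x) eps; first by apply/subset_closure/int.
  move=> U /nbhs_enormP[e e'0 he].
  have [a na] := nearest_nonempty x cY Y0.
  have Dx : 0 < distf Y x by apply: lt_le_trans ex.
  pose t := Num.min 1 (e / (2 * distf Y x)).
  have t0 : 0 < t by rewrite lt_min ltr01 divr_gt0 ?mulr_gt0.
  have t1 : t <= 1 by rewrite ge_min lexx.
  have te : t * distf Y x <= e / 2.
    by rewrite -ler_pdivlMr// -mulrA -invfM ge_min lexx orbT.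
  exists (x + t *: (a - x)); split.
    apply: int; rewrite (distf_segment na) ?(ltW t0)//.
    move: Xx; rewrite /X /= => Xx.
    have : 0 < t * distf Y x by exact: mulr_gt0.
    by lra.
  apply: he; rewrite [x + _]addrC addrK enormZ_ge0 ?(ltW t0)// enormB.
  by case: na => _ ->; lra.
(* Capping at 1 only serves the range of [mu]; the bound [s] is both the gradient bound and the
   width of the shell. *)
- exists (Num.min s 1); first by rewrite lt_min s0 ltr01 ge_min lexx orbT.
  apply: (@lt_le_trans _ _ s%:E); first by rewrite lte_fin.
  apply: ereal_sup_ubound; exists s => // x /andP[Xx0 Xxs].
  have ex : eps < distf Y x.
    rewrite ltNge; apply/negP => Xx; move: Xx0.
    by rewrite (@distf_id _ _ X x Xx) ltxx.
  have XE y : eps < distf Y y -> distf X y = distf Y y - eps.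
    exact: (distf_offset cY Y0 (ltW e0)).
  apply: le_ereal_inf_tmp => _ [v hv <-]; rewrite lee_fin ge_min; apply/orP; left.
  apply: (hs x); first by move: Xxs; rewrite XE// (ltW ex); lra.
  apply: (@clarke_distf_sub _ _ Y (distf X) x (- eps) (distf Y x - eps)) => //.
  - by rewrite subr_gt0.
  - move=> y yx; apply: XE; have := distf_lipschitz Y x y; rewrite enormB; lra.
  - exact: lt_trans ex.
- rewrite regular_sublevel_compl//; apply: (@superlevel_reach Y eps s) => // x v xe.
  by apply: hs; rewrite xe lexx lerDl ltW.
Qed.

End OffsetRegular.

(** * Complementary regular sets as offsets *)

Section ComplementaryRegular.
Context {R : realType} {d : nat}.
Local Notation V := 'rV[R]_d.
Implicit Types (x y z a : V) (A X Y : set V).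

Lemma reach_gt0 A : (0 < reach A)%E -> exists2 r : R, 0 < r &
  forall x a b, distf A x < r -> nearest A x a -> nearest A x b -> a = b.
Proof.
move=> /ereal_sup_gt[_ [r [r0 hr] <-]]; rewrite lte_fin => rpos; exists r => // x a b xr.
move=> [Aa xa] [Ab xb]; have A0 : A !=set0 by exists a.
have [|c [_ cu]] := hr x; first by rewrite edistfE// lte_fin.
by rewrite -(cu a) ?(cu b)// edistfE// ?xa ?xb.
Qed.

(* Where nearest points are unique the distance function has slope 1, so it can
   be climbed at every rate s < 1. *)
Lemma unique_nearest_ascent A x (r : R) : closed A -> A !=set0 ->
  (forall z a b, distf A z < r -> nearest A z a -> nearest A z b -> a = b) ->
  0 < distf A x < r ->
  exists y, r <= distf A y /\ enorm (x - y) <= r - distf A x.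
Proof.
move=> cA A0 hr /andP[Dx xr]; pose rho := r - distf A x.
have rho0 : 0 < rho by rewrite subr_gt0.
have climb (s : R) : 0 < s < 1 ->
    exists z, enorm (z - x) <= rho /\ distf A x + s * rho <= distf A z.
  move=> /andP[s0 s1]; apply: distf_climb => //; first exact: ltW.
  move=> z zx zs e e0.
  have Dz : 0 < distf A z.
    by apply: lt_le_trans zs; rewrite ltr_wpDr// mulr_ge0 ?enorm_ge0// ltW.
  have zr : distf A z < r by have := distf_lipschitz A z x; rewrite /rho in zx; lra.
  have [q nq] := nearest_nonempty z cA A0; have [Aq zq] := nq.
  have sD0 : 0 <= s * distf A z by rewrite mulr_ge0 ?ltW.
  (* The direction [z - q] has length [distf A z], so the rate [s] per unit length is scaled by
     it. *)
  have [a na|e1 e10 he] := @distf_ascent _ _ A z (z - q) (s * distf A z) cA A0 sD0 Dz.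
    by rewrite (hr z a q)// -sqr_enorm zq expr2 -mulrA gtr_pMl ?mulr_gt0.
  pose m := Num.min e1 (e / distf A z).
  have m0 : 0 < m by rewrite lt_min e10 divr_gt0.
  have m1 : m <= e1 by rewrite ge_min lexx.
  have m2 : m * distf A z <= e by rewrite -ler_pdivlMr// ge_min lexx orbT.
  exists (z + (m / 2) *: (z - q)); rewrite [z + _]addrC addrK enormZ_ge0; last lra.
  rewrite zq; split; first by have := mulr_gt0 m0 Dz; lra.
  rewrite [_ *: _ + z]addrC.
  have -> : s * (m / 2 * distf A z) = s * distf A z * (m / 2) by ring.
  by apply: he; apply/andP; split; lra.
pose B := [set z | enorm (z - x) <= rho].
have cB : compact B by apply: (@enorm_bounded_compact _ _ _ x rho) => //; exact: closed_enorm_le.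
have B0 : B !=set0 by exists x; rewrite /B /= subrr enorm0 ltW.
have [y] := compact_EVT_max B0 cB (continuous_subspaceT (@distf_continuous _ _ A)).
rewrite inE => By ymax; exists y; split; last by rewrite enormB.
rewrite leNgt; apply/negP => yr.
(* The second term is halfway between the slope realized by the maximizer [y] and 1, so climbing at
   rate [s] would beat [y]. *)
pose s := Num.max (1 / 2) ((distf A y - distf A x + rho) / (2 * rho)).
have s01 : 0 < s < 1.
  rewrite lt_max gt_max divr_gt0//= ltr_pdivrMr// mul1r ltr_pdivrMr ?mulr_gt0//.
  by rewrite /rho; apply/andP; split; lra.
have [z [zx zs]] := climb s s01.
have := ymax z; rewrite inE => /(_ zx) zy.
have : (distf A y - distf A x + rho) / 2 <= s * rho.
  by rewrite -ler_pdivrMr// -mulrA -invfM le_max lexx orbT.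
by rewrite /rho; rewrite /rho in zs *; lra.
Qed.

Lemma reach_mu_gt0 X (mu : R) : (0 < reach_mu mu X)%E -> exists2 s : R, 0 < s &
  forall x v, 0 < distf X x <= s -> clarke_grad (distf X) x v -> mu <= enorm v.
Proof.
move=> /ereal_sup_gt[_ [s hs <-]]; rewrite lte_fin => s0; exists s => // x v xs hv.
rewrite -lee_fin; apply: le_trans (hs x xs) _.
by apply: ereal_inf_lbound; exists v.
Qed.

(** The least-norm element [v] of the hull of normals is an ascent direction at rate at least
    [enorm v] per unit length. This supplies the hypothesis of [distf_climb]. *)
Lemma reach_mu_ascent X (mu s : R) x : closed X -> X !=set0 -> 0 < mu -> 0 < distf X x ->
  (forall v, clarke_grad (distf X) x v -> mu <= enorm v) -> 0 <= s < mu ->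
  forall e : R, 0 < e -> exists y, enorm (y - x) < e /\
        distf X x + s * enorm (y - x) < distf X y.
Proof.
move=> cX X0 mu0 Dx hmu /andP[s0 smu] e e0.
have N0 : normals X x !=set0.
  by have [a na] := nearest_nonempty x cX X0; exists ((distf X x)^-1 *: (x - a)), a.
have [v hv vmin] := hull_min (@normals_compact _ _ X x cX) N0.
have vmu := hmu v (sub_clarke_distf Dx hv).
have v0 : 0 < enorm v by apply: lt_le_trans vmu.
have sv0 : 0 <= s * enorm v by rewrite mulr_ge0// ltW.
have [a na|e1 e10 he] := @distf_ascent _ _ X x v (s * enorm v) cX X0 sv0 Dx.
  have /vmin : normals X x ((distf X x)^-1 *: (x - a)) by exists a.
  rewrite edotZr -sqr_enorm ler_pdivlMl// => h; apply: lt_le_trans h.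
  rewrite mulrC ltr_pM2l// expr2 ltr_pM2r//; exact: lt_le_trans vmu.
pose m := Num.min e1 (e / enorm v).
have m0 : 0 < m by rewrite lt_min e10 divr_gt0.
have m1 : m <= e1 by rewrite ge_min lexx.
have m2 : m * enorm v <= e by rewrite -ler_pdivlMr// ge_min lexx orbT.
exists (x + (m / 2) *: v); rewrite [x + _]addrC addrK enormZ_ge0; last lra.
split; first by have := mulr_gt0 m0 v0; lra.
rewrite [_ *: _ + x]addrC.
have -> : s * (m / 2 * enorm v) = s * enorm v * (m / 2) by ring.
by apply: he; apply/andP; split; lra.
Qed.

(* If 0 were in the Clarke gradient of d_Y at x, then d_Y^2 <= eps^2 + |. - x|^2
   around x, so d_Y could not grow linearly when leaving X near x. *)
Lemma boundary_regular X Y (mu s eps : R) x : closed Y -> Y !=set0 -> 0 < eps ->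
  X = [set y | distf Y y <= eps] -> 0 < mu -> 0 < s ->
  (forall z v, 0 < distf X z <= s -> clarke_grad (distf X) z v -> mu <= enorm v) ->
  distf Y x = eps -> closure (~` X) x -> ~ clarke_grad (distf Y) x 0.
Proof.
move=> cY Y0 e0 XE mu0 s0 hmu xe clx h0.
have Dx : 0 < distf Y x by rewrite xe.
have {}h0 : hull (normals Y x) 0.
  by apply: (@clarke_distf_sub _ _ Y (distf Y) x 0 1) h0 => // y _; rewrite addr0.
(* Expand [z - a] around [x] for each nearest [a]; the linear terms cancel in the convex combination
   giving 0. *)
have quad z : distf Y z ^+ 2 <= eps ^+ 2 + edot (z - x) (z - x).
  pose m := (distf Y z ^+ 2 - eps ^+ 2 - edot (z - x) (z - x)) / (2 * eps).
  have : m <= edot (z - x) 0.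
    apply: (hull_normals_edot Dx _ h0) => a [Ya xa].
    rewrite xe /m invfM mulrA divfK ?gt_eqF//.
    have : distf Y z ^+ 2 <= edot (z - a) (z - a).
      by rewrite -sqr_enorm ler_sqr ?nnegrE ?enorm_ge0 ?distf_ge0// distf_le.
    have -> : z - a = (z - x) + (x - a) by rewrite addrA subrK.
    rewrite (edotDl (z - x)) !(edotDr _ (z - x)) -(sqr_enorm (x - a)) xa xe.
    rewrite (edotC (x - a)).
    by lra.
  by rewrite edotC edot0l /m ler_pdivrMr ?mulr_gt0// mul0r; lra.
have cX : closed X.
  rewrite XE; apply: (preimage_closed _ (@closed_le R eps)) => w _.
  exact: distf_continuous.
have X0 : X !=set0 by exists x; rewrite XE /= xe.
(* [s / 2] keeps the climb, within [2 * rho] of [x], in the shell where [hmu] applies;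
   [eps * mu / 8] makes [4 * rho ^+ 2] smaller than the gain [eps * mu * rho]. *)
pose rho := Num.min (s / 2) (eps * mu / 8).
have rho0 : 0 < rho by rewrite lt_min !divr_gt0// mulr_gt0.
have rho1 : rho <= s / 2 by rewrite ge_min lexx.
have rho2 : rho <= eps * mu / 8 by rewrite ge_min lexx orbT.
have [x' [nXx' x'x]] : exists x', ~ X x' /\ enorm (x' - x) < rho.
  have [|x' [? ?]] := clx [set y | enorm (y - x) < rho]; last by exists x'.
  by apply/nbhs_enormP; exists rho.
have Xx : X x by rewrite XE /= xe.
have Dx' : 0 < distf X x'.
  rewrite lt_neqAle distf_ge0 andbT; apply/eqP => /esym/(distf_eq0 cX X0).
  exact: nXx'.
have [z1 [z2a z2b]] : exists z, enorm (z - x') <= rho /\ distf X x' + mu / 2 * rho <= distf X z.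
  apply: distf_climb => //; first by rewrite divr_ge0 ?ltW.
  move=> z zx' zD; apply: (@reach_mu_ascent _ mu) => //.
  - by apply: lt_le_trans zD; rewrite ltr_wpDr// mulr_ge0 ?enorm_ge0// divr_ge0// ltW.
  - move=> v; apply: hmu; apply/andP; split.
      by apply: lt_le_trans zD; rewrite ltr_wpDr// mulr_ge0 ?enorm_ge0// divr_ge0// ltW.
    by have := distf_lipschitz X z x; rewrite (distf_id Xx); have := enorm_triangle x' z x; lra.
  - by apply/andP; split; lra.
have zX : eps < distf Y z1.
  rewrite ltNge; apply/negP => zXle; have Xz : X z1 by rewrite XE.
  by have := mulr_gt0 mu0 rho0; rewrite (distf_id Xz) in z2b; lra.
have zE : distf X z1 = distf Y z1 - eps by rewrite XE distf_offset// ltW.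
have h1 : eps + mu / 2 * rho <= distf Y z1 by lra.
have h2 := quad z1.
have h3 : enorm (z1 - x) <= 2 * rho by have := enorm_triangle x' z1 x; lra.
have h4 : edot (z1 - x) (z1 - x) <= (2 * rho) ^+ 2.
  by rewrite -sqr_enorm ler_sqr ?nnegrE ?enorm_ge0// mulr_ge0// ltW.
have mr : 0 < mu / 2 * rho by rewrite mulr_gt0// divr_gt0.
have h5 : (eps + mu / 2 * rho) ^+ 2 <= distf Y z1 ^+ 2.
  by rewrite ler_sqr// nnegrE ?distf_ge0//; lra.
have h6 : rho * rho <= rho * (eps * mu / 8) by rewrite ler_pM2l.
have h7 : 0 < rho * (eps * mu) by rewrite !mulr_gt0.
by nra.
Qed.

Lemma comp_regular_offset X : comp_regular X -> exists Y (eps : R),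
  [/\ compact Y, 0 < eps, regular_value (distf Y) eps &
      X = [set x | (edistf Y x <= eps%:E)%E]].
Proof.
move=> [kX XE [mu /andP[mu0 _] /reach_mu_gt0[s s0 hmu]] /reach_gt0[r r0 hr]].
have [X00|/set0P X0] := eqVneq X set0.
  (* The value 1 is trivially regular, since [distf set0] is constantly 0. *)
  exists set0, 1; split=> //; first exact: compact0.
    by move=> x; rewrite /distf edistf_set0 /= => /esym/eqP; rewrite oner_eq0.
  by rewrite X00; apply/seteqP; split=> x //=; rewrite edistf_set0.
have cX := compact_closed (@norm_hausdorff _ _) kX.
set A := compl_set X in hr.
have cA : closed A by exact: closed_closure.
have nXA x : ~ X x -> A x by move=> nXx; exact: subset_closure.
(* Here [X] is the whole space, compact only in dimension 0. *)
have [A00|/set0P A0] := eqVneq A set0.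
  have XT x : X x by apply: contrapT => /nXA; rewrite A00.
  exists X, 1; split=> //.
    by move=> x; rewrite distf_id// => /esym/eqP; rewrite oner_eq0.
  by apply/seteqP; split=> x //= _; rewrite edistfE// distf_id// lee_fin.
pose eps := r / 2; have e0 : 0 < eps by rewrite divr_gt0.
have er : eps < r by rewrite /eps; lra.
pose Y := [set y | eps <= distf A y].
have cY : closed Y.
  by apply: (preimage_closed _ (@closed_ge R eps)) => w _; exact: distf_continuous.
have YX y : Y y -> X y.
  move=> Yy; apply: contrapT => /nXA Ay.
  by move: Yy; rewrite /Y /= distf_id//; lra.
have kY : compact Y by apply: (subclosed_compact cY kX).
(* The maximum with 0 covers points already in [Y]. *)
have near_Y x : 0 < distf A x -> exists y, Y y /\ enorm (x - y) <= Num.max 0 (eps - distf A x).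
  move=> Dx; have [ex|xe] := leP eps (distf A x).
    by exists x; split=> //; rewrite subrr enorm0 le_max lexx.
  have [||y [ye yx]] := @unique_nearest_ascent A x eps cA A0.
  - by move=> z a b ze; apply: hr; exact: lt_trans er.
  - by rewrite Dx.
  by exists y; split=> //; rewrite le_max yx orbT.
have intX x : interior X x -> 0 < distf A x.
  move=> /nbhs_enormP[e e'0 he]; rewrite lt_neqAle distf_ge0 andbT.
  apply/eqP => /esym/(distf_eq0 cA A0) Ax.
  have [|y [nXy yx]] := Ax [set y | enorm (y - x) < e]; first by apply/nbhs_enormP; exists e.
  by apply: nXy; exact: he.
have [x1 ix1] : interior X !=set0.
  apply/set0P/eqP => iX; move: XE; rewrite iX closure0 => X00.
  by case: X0 => x; rewrite -X00.
have Y0 : Y !=set0 by have [y [Yy _]] := near_Y x1 (intX _ ix1); exists y.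
have YE : X = [set x | distf Y x <= eps].
  have cYe : closed [set x | distf Y x <= eps].
    by apply: (preimage_closed _ (@closed_le R eps)) => w _; exact: distf_continuous.
  apply/seteqP; split.
    rewrite -{1}XE [X in _ `<=` X]((closure_id _).1 cYe); apply: closureS => x /intX Dx /=.
    have [y [Yy yx]] := near_Y x Dx; apply: le_trans (distf_le x Yy) (le_trans yx _).
    by rewrite ge_max; apply/andP; split; lra.
  (* A short step from [x] towards its nearest [y] in [Y] stays outside [X], giving a point of [A]
     closer than [eps] to [y]. *)
  move=> x /= xe; apply: contrapT => nXx.
  have [y [Yy yx]] := nearest_nonempty x cY Y0.
  have [e e'0 he] : exists2 e : R, 0 < e & forall z, enorm (z - x) < e -> ~ X z.
    apply/nbhs_enormP; apply: open_nbhs_nbhs; split=> //; exact: closed_openC.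
  have xy0 : 0 < enorm (x - y).
    rewrite lt_neqAle enorm_ge0 andbT; apply/eqP => /esym/enorm_eq0/eqP.
    by rewrite subr_eq0 => /eqP xyE; apply: nXx; rewrite xyE; exact: YX.
  pose t := Num.min 1 (e / (2 * enorm (x - y))).
  have t0 : 0 < t by rewrite lt_min ltr01 divr_gt0 ?mulr_gt0.
  have t1 : t <= 1 by rewrite ge_min lexx.
  have te : t * enorm (x - y) <= e / 2.
    by rewrite -ler_pdivlMr// -mulrA -invfM ge_min lexx orbT.
  have Az : A (x + t *: (y - x)).
    apply/nXA/he; rewrite [x + _]addrC addrK enormZ_ge0 ?(ltW t0)// enormB; lra.
  have := distf_le y Az; rewrite (_ : y - _ = (1 - t) *: (y - x)); last first.
    by apply/rowP => i; rewrite !mxE; ring.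
  rewrite enormZ_ge0 ?subr_ge0// enormB; move: Yy; rewrite /Y /= => Yy.
  by have := mulr_gt0 t0 xy0; lra.
exists Y, eps; split=> //; last by rewrite edistf_sublevelE.
move=> x xe; apply: (boundary_regular cY Y0 e0 YE mu0 s0 hmu xe).
(* Off [A], [near_Y] would find a point of [Y] closer to [x] than [eps]. *)
apply: contrapT => nAx.
have Dx : 0 < distf A x.
  by rewrite lt_neqAle distf_ge0 andbT; apply/eqP => /esym/(distf_eq0 cA A0).
have [y [Yy yx]] := near_Y x Dx.
have := distf_le x Yy; rewrite xe => h.
have := le_trans h yx; rewrite le_max => /orP[]; lra.
Qed.

End ComplementaryRegular.

Theorem mainTheorem5 (R : realType) (d : nat) (X : set 'rV[R]_d) :
  comp_regular X <->
  exists (Y : set 'rV[R]_d) (eps : R),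
    [/\ compact Y, 0 < eps, regular_value (distf Y) eps &
        X = [set x | (edistf Y x <= eps%:E)%E]].
Proof.
split=> [/comp_regular_offset //|[Y [eps [kY e0 reg ->]]]].
exact: regular_sublevel_comp_regular.
Qed.
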